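(* For all integers $1\le d\le k-1$ such that $d\mid k$, it holds that $\beta_d(k)\le\beta_1(k/d)$.
   Context: A $k$-uniform hypergraph $G=(V,E)$ consists of a finite vertex set $V$ and a set $E$ of $k$-element subsets of $V$ (edges). For a $d$-subset $A$ of $V$, $\deg_d A$ is the number of edges containing $A$, and $\delta_d(G)$ is the minimum of $\deg_d A$ over all $d$-subsets $A$ of $V$. A fractional perfect matching of $G$ is a weight assignment $\mathbf{x}\in[0,1]^E$ such that $\sum_{e\ni v}\mathbf{x}_e=1$ for every $v\in V$. Its entropy is $h(\mathbf{x}):=-\sum_{e\in E}\mathbf{x}_e\ln\mathbf{x}_e$ (with $0\ln 0=0$), and the entropy of $G$ is $h(G):=\sup_{\mathbf{x}}h(\mathbf{x})$ over all fractional perfect matchings $\mathbf{x}$ of $G$ (with value $-\infty$ if there are none). For integers $1\le d\le k-1$, the $d$-degree $k$-uniform approximate counting threshold $\beta_d(k)$ is the minimum $\beta>0$ such that for all $\gamma,\epsilon>0$ there exists $n_0$ such that for all $n\ge n_0$ (no divisibility relation between $k$ and $n$ is assumed), if $G$ is a $k$-uniform $n$-vertex hypergraph with $\delta_d(G)\ge(\beta+\gamma)\binom{n-d}{k-d}$, then $h(G)\ge\frac{n}{k}\ln\left((1-\epsilon)\frac{k}{n}\frac{\binom{n}{d}}{\binom{k}{d}}\delta_d(G)\right)$. *)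

(* Defs.v *)
From HB Require Import structures.
From mathcomp Require Import all_boot all_order all_algebra.
From mathcomp Require Import all_classical all_reals all_analysis.
From mathcomp Require Import ring lra zify.
Set Implicit Arguments.
Unset Strict Implicit.
Unset Printing Implicit Defensive.
Import Order.TTheory GRing.Theory Num.Theory.
Local Open Scope ring_scope.

Record uhypergraph (k : nat) (V : finType) := UHypergraph {
  edges : {set {set V}};
  edges_card : {in edges, forall e : {set V}, #|e| = k}
}.

Definition deg (k : nat) (V : finType) (G : uhypergraph k V) (A : {set V}) : nat :=
  #|[set e in edges G | A \subset e]|.

(* The default value #|edges G| bounds every degree, so it does not affect the
   minimum as soon as V has a d-subset. *)
Definition min_deg (k : nat) (V : finType) (G : uhypergraph k V) (d : nat) : nat :=
  \big[minn/#|edges G|]_(A : {set V} | #|A| == d) deg G A.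

(* Weights are functions on all subsets of V, of which only the values on edges
   are ever used. *)
Definition fractional_perfect_matching (R : realType) (k : nat) (V : finType)
    (G : uhypergraph k V) (x : {set V} -> R) : Prop :=
  {in edges G, forall e : {set V}, 0 <= x e <= 1} /\
  (forall v : V, \sum_(e in edges G | v \in e) x e = 1).

(* ln 0 = 0 in the library, whence 0 * ln 0 = 0 as required. *)
Definition entropy (R : realType) (k : nat) (V : finType)
    (G : uhypergraph k V) (x : {set V} -> R) : R :=
  - \sum_(e in edges G) x e * ln (x e).

(* ereal_sup set0 = -oo. *)
Definition hypergraph_entropy (R : realType) (k : nat) (V : finType)
    (G : uhypergraph k V) : \bar R :=
  ereal_sup [set (entropy G x)%:E | x in
    [set x : {set V} -> R | fractional_perfect_matching G x]]%classic.

(* lne is the extended-real logarithm, with lne r = -oo for r <= 0: the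
   inequality on the entropy is void when eps >= 1. *)
Definition approx_counting (R : realType) (d k : nat) (beta : R) : Prop :=
  forall gamma eps : R, 0 < gamma -> 0 < eps ->
  exists n0 : nat, forall n : nat, (n0 <= n)%N ->
  forall (V : finType) (G : uhypergraph k V), #|V| = n ->
  (beta + gamma) * 'C(n - d, k - d)%:R <= (min_deg G d)%:R ->
  ((n%:R / k%:R)%:E *
     lne ((1 - eps) * (k%:R / n%:R) * ('C(n, d)%:R / 'C(k, d)%:R)
            * (min_deg G d)%:R)%:E
   <= hypergraph_entropy R G)%E.

(* This infimum is a minimum, see counting_threshold_min below. *)
Definition counting_threshold (R : realType) (d k : nat) : R :=
  inf [set beta : R | 0 < beta /\ approx_counting d k beta]%classic.

Section Minimum.
Variables (R : realType) (d k : nat).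
Hypotheses (d_gt0 : (1 <= d)%N) (d_ltk : (d <= k - 1)%N).

Let card_supersets (V : finType) (j : nat) (D : {set V}) : (#|D| <= j)%N ->
  #|[set e : {set V} | (#|e| == j) && (D \subset e)]| = 'C(#|V| - #|D|, j - #|D|).
Proof.
move=> Dj; have -> : (#|V| - #|D|)%N = #|~: D| by rewrite [RHS]cardsCs finset.setCK.
rewrite -[RHS]cards_draws.
have -> : [set e : {set V} | (#|e| == j) && (D \subset e)] =
  [set B :|: D | B in [set B : {set V} | B \subset ~: D & #|B| == (j - #|D|)%N]].
  apply/setP=> e; rewrite inE; apply/andP/imsetP=> [[/eqP ej De]|[B]].
    exists (e :\: D); last by rewrite finset.setUC finset.setDE finset.setUIr finset.setUCr finset.setIT; exact/esym/finset.setUidPr.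
    rewrite inE cardsD (finset.setIidPr De) ej eqxx andbT finset.setDE; exact: finset.subsetIr.
  rewrite inE => /andP[BD /eqP cB] ->; rewrite finset.subsetUr; split=> //.
  rewrite cardsU; have -> : B :&: D = finset.set0.
    by apply/finset.disjoint_setI0; rewrite finset.disjoints_subset.
  by rewrite cards0 subn0 cB subnK.
apply: card_in_imset => B C; rewrite !inE => /andP[BD _] /andP[CD _] eBC.
have aux (X : {set V}) : X \subset ~: D -> (X :|: D) :\: D = X.
  by move=> XD; rewrite finset.setDUl finset.setDv finset.setU0 finset.setDE; exact/finset.setIidPl.
by rewrite -(aux _ BD) -(aux _ CD) eBC.
Qed.

Let min_deg_le (V : finType) (G : uhypergraph k V) : (d <= #|V|)%N ->
  (min_deg G d <= 'C(#|V| - d, k - d))%N.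
Proof.
move=> dV; have := cards_draws [set: V] d; rewrite cardsT => cdr.
have : (0 < 'C(#|V|, d))%N by rewrite bin_gt0.
rewrite -cdr => /card_gt0P[A]; rewrite inE => /andP[_ cA].
have mA : (min_deg G d <= deg G A)%N.
  by rewrite /min_deg -minEnat -leEnat; exact: bigmin_le_cond.
apply: (leq_trans mA).
have dk : (#|A| <= k)%N by rewrite (eqP cA); lia.
rewrite -(eqP cA) -(card_supersets dk) /deg; apply/subset_leq_card/fintype.subsetP => e.
by rewrite !inE => /andP[eG ->]; rewrite (edges_card eG) eqxx.
Qed.

Let approx_counting1 : approx_counting d k (1 : R).
Proof.
move=> gamma eps g0 e0; exists k => n kn V G cV.
have dn : (d <= #|V|)%N by rewrite cV; lia.
have := min_deg_le G dn; rewrite cV -(ler_nat R) => le1 le2.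
have C0 : 0 < 'C(n - d, k - d)%:R :> R by rewrite ltr0n bin_gt0; lia.
exfalso; have : 0 < gamma * 'C(n - d, k - d)%:R by rewrite mulr_gt0.
lra.
Qed.

Let touching (V : finType) (S : {set V}) : uhypergraph k V.
Proof.
exists [set e : {set V} | (#|e| == k) && (e :&: S != finset.set0)].
by move=> e; rewrite inE => /andP[/eqP].
Defined.

Let sum_cap (V : finType) (E : pred {set V}) (S : {set V}) (T : nmodType)
    (x : {set V} -> T) :
  \sum_(v in S) \sum_(e | E e && (v \in e)) x e = \sum_(e | E e) x e *+ #|e :&: S|.
Proof.
rewrite (exchange_big_dep E) => [|v e _ /andP[]//]; apply: eq_bigr => e Ee /=.
rewrite sumr_const; congr (_ *+ _); apply: eq_card => v.
by rewrite -topredE /= !inE Ee andbC.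
Qed.

Let touching_entropy (V : finType) (S : {set V}) : (k * #|S| < #|V|)%N ->
  hypergraph_entropy R (touching S) = -oo%E.
Proof.
move=> kS; rewrite /hypergraph_entropy.
rewrite [X in image X _](_ : _ = set0)%classic ?image_set0 ?ereal_sup0 //.
rewrite -classical_sets.subset0 => x /= [x01 x1].
have e1 := sum_cap (mem (edges (touching S))) S x.
have e2 := sum_cap (mem (edges (touching S))) finset.setT x.
have {}e1 : #|S|%:R = \sum_(e in edges (touching S)) x e *+ #|e :&: S|.
  by rewrite -[RHS]e1 (eq_bigr (fun=> 1)) ?sumr_const// => v _; exact: x1.
have {}e2 : #|V|%:R = k%:R * \sum_(e in edges (touching S)) x e.
  transitivity (\sum_(v in [set: V]) \sum_(e in edges (touching S) | v \in e) x e).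
    by rewrite (eq_bigr (fun=> 1)) ?sumr_const ?cardsT// => v _; exact: x1.
  rewrite [LHS]e2 big_distrr /=; apply: eq_bigr => e eG.
  by rewrite finset.setIT (@edges_card k V (touching S) e eG) mulr_natl.
have : \sum_(e in edges (touching S)) x e <= #|S|%:R.
  rewrite e1; apply: ler_sum => e eG; have /andP[xe0 _] := x01 e eG.
  move: eG; rewrite inE => /andP[_]; rewrite -card_gt0.
  by case: #|_| => // m _; rewrite mulrS lerDl mulrn_wge0.
have : k%:R * #|S|%:R < #|V|%:R :> R by rewrite -natrM ltr_nat.
rewrite e2 => lt1 le1; have := lt_le_trans lt1 (ler_wpM2l (ler0n R k) le1).
by rewrite ltxx.
Qed.

Let touching_deg (V : finType) (S D : {set V}) :
  #|V| = (k * #|S|).+1 -> (0 < #|S|)%N -> #|D| = d ->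
  ('C(#|V| - d, k - d) <= k * k.+1 * deg (touching S) D)%N.
Proof.
move=> cV S0 cD; have Dk : (#|D| <= k)%N by lia.
have [DS0|DS] := eqVneq (D :&: S) finset.set0; last first.
  rewrite -cD -(card_supersets Dk); apply: (@leq_trans (deg (touching S) D)); last first.
    by rewrite leq_pmull// muln_gt0; lia.
  apply/subset_leq_card/fintype.subsetP => e; rewrite !inE => /andP[-> De]; rewrite De andbT /=.
  by apply: contraNneq DS => eS0; rewrite -finset.subset0 -eS0 finset.setSI.
pose L := [set e in edges (touching S) | D \subset e].
have dc := sum_cap (mem L) S (fun=> 1%N).
have ub : (\sum_(e in L) #|e :&: S| <= k * deg (touching S) D)%N.
  rewrite mulnC -sum_nat_const; apply: leq_sum => e.
  rewrite !inE => /andP[/andP[/eqP <- _] _].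
  exact/subset_leq_card/finset.subsetIl.
have lb : (\sum_(v in S) \sum_(e | mem L e && (v \in e)) 1 =
    #|S| * 'C((#|V| - d).-1, (k - d).-1))%N.
  rewrite -sum_nat_const; apply: eq_bigr => v vS.
  have vD : v \notin D.
    by apply/negP => vD; move/setP/(_ v): DS0; rewrite finset.in_setI finset.in_set0 vD vS.
  have cvD : #|v |: D| = d.+1 by rewrite cardsU1 vD cD.
  have vDk : (#|v |: D| <= k)%N by lia.
  rewrite -!subnS -cvD -(card_supersets vDk) sum1dep_card.
  apply: eq_card => e; rewrite !inE /= ?inE finset.subUset finset.sub1set.
  case: (#|e| == k) => //=; case: (boolP (v \in e)) => ve; rewrite ?andbF//= ?andbT.
  suff -> : e :&: S != finset.set0 by [].
  by apply/finset.set0Pn; exists v; rewrite inE ve.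
have {}dc : (#|S| * 'C((#|V| - d).-1, (k - d).-1) = \sum_(e in L) #|e :&: S|)%N.
  rewrite -lb [LHS]dc; apply: eq_bigr => e _.
  exact: natn.
have := mul_bin_diag (#|V| - d) (k - d).-1.
have -> : (k - d).-1.+1 = (k - d)%N by lia.
rewrite -dc in ub.
set C := 'C(#|V| - d, k - d); set C' := 'C(_, _) in ub *.
set g := deg _ _ in ub *; set a := #|S| in ub cV S0 *.
move=> eC; have kd : (0 < k - d)%N by lia.
have le1 : (a * C <= a * ((k - d) * C))%N by rewrite leq_mul2l leq_pmull ?orbT.
have le2 : ((#|V| - d) * (a * C') <= (k.+1 * a) * (k * g))%N.
  by apply: leq_mul => //; rewrite cV; nia.
rewrite -(leq_pmul2l S0); nia.
Qed.

Let lower_bound (beta : R) : approx_counting d k beta -> (k * k.+1)%:R^-1 <= beta.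
Proof.
move=> ac; rewrite leNgt; apply/negP => lt_b.
set c := _^-1 in lt_b.
have k0 : (0 < k)%N by lia.
have c0 : 0 < c by rewrite invr_gt0 ltr0n muln_gt0 k0.
have [n0 /(_ (k * n0.+1).+1)] := ac (c - beta) 2^-1 ltac:(lra) ltac:(lra).
set n := (k * n0.+1).+1 => H.
have n0n : (n0 <= n)%N by rewrite /n; nia.
have kn : (k <= n)%N by rewrite /n; nia.
have : (0 < 'C(n, n0.+1))%N by rewrite bin_gt0 /n; nia.
rewrite -{1}(card_ord n) -cardsT -cards_draws => /card_gt0P[S].
rewrite inE => /andP[_ /eqP cS].
have cV : #|'I_n| = (k * #|S|).+1 by rewrite card_ord cS.
have S0 : (0 < #|S|)%N by rewrite cS.
have md : ('C(n - d, k - d) <= k * k.+1 * min_deg (touching S) d)%N.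
  have D1 (D : {set 'I_n}) : #|D| == d ->
      ('C(n - d, k - d) <= k * k.+1 * deg (touching S) D)%N.
    by move=> /eqP; have := @touching_deg _ S D cV S0; rewrite card_ord.
  rewrite /min_deg; elim/big_ind: _ => //.
    have : (0 < 'C(n, d))%N by rewrite bin_gt0; lia.
    rewrite -{1}(card_ord n) -cardsT -cards_draws => /card_gt0P[D].
    rewrite inE => /andP[_ /D1/leq_trans]; apply; rewrite leq_mul2l orbC.
    by rewrite subset_leq_card//; apply/fintype.subsetP => e; rewrite inE => /andP[].
  by move=> x y hx hy; rewrite minnMr leq_min hx.
have C0 : (0 < 'C(n - d, k - d))%N by rewrite bin_gt0; lia.
have := H n0n _ (touching S) (card_ord n).
rewrite touching_entropy ?cV//.
rewrite leeNy_eq addrC subrK => /(_ _)/wrap[].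
  by rewrite /c ler_pdivrMl ?ltr0n ?muln_gt0 ?k0// -natrM ler_nat.
have m0 : (0 < min_deg (touching S) d)%N.
  by rewrite lt0n; apply: contraTneq md => ->; rewrite muln0 -ltnNge.
rewrite lne_EFin//.
have -> : (1 - 2^-1 : R) = 2^-1 by lra.
by rewrite !mulr_gt0 ?invr_gt0 ?ltr0n ?bin_gt0 //; lia.
Qed.

Lemma counting_threshold_min :
  (0 < counting_threshold R d k /\ approx_counting d k (counting_threshold R d k)) /\
  (forall beta : R, 0 < beta -> approx_counting d k beta ->
     counting_threshold R d k <= beta).
Proof.
set B : set R := [set beta : R | 0 < beta /\ approx_counting d k beta]%classic.
have B1 : (B !=set0)%classic by exists 1; split.
have Blb : has_lbound B by exists 0 => b [/ltW].
have t0 : 0 < counting_threshold R d k.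
  apply: (@lt_le_trans _ _ (k * k.+1)%:R^-1).
    by rewrite invr_gt0 ltr0n muln_gt0; lia.
  by apply: lb_le_inf => // b [_]; exact: lower_bound.
split; last by move=> b b0 acb; apply: ge_inf.
split=> // gamma eps g0 e0.
have [b [b0 acb] ltb] := @inf_adherent R B (gamma / 2) ltac:(lra) (conj B1 Blb).
have [n0 Hn0] := acb (gamma / 2) eps ltac:(lra) e0.
exists n0 => n n0n V G cV le1; apply: Hn0 => //; apply: le_trans le1.
apply: ler_wpM2r; first exact: ler0n.
by have := ltW ltb; rewrite /counting_threshold -/B; lra.
Qed.

End Minimum.

(* Main.v *)
Require Import Defs.
From mathcomp Require Import all_boot all_order all_algebra.
From mathcomp Require Import all_classical all_reals all_analysis.
From mathcomp Require Import fingroup perm ring lra zify.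
From mathcomp Require Import fintype finset.
Set Implicit Arguments.
Unset Strict Implicit.
Unset Printing Implicit Defensive.
Import Order.TTheory GRing.Theory Num.Theory.
Local Open Scope ring_scope.

(** Put q = k / d, and let G be a k-uniform hypergraph on n vertices whose
minimum d-degree is at least (beta + gamma) C(n-d, k-d), where beta is the
threshold of degree 1 and uniformity q.  Group all but n mod d vertices into
m = n / d blocks of d vertices, and let a uniformly random permutation s of the
vertices move the blocks.  The sets of q blocks whose union is an edge of G are
the edges of a q-uniform hypergraph H_s on m vertices.  Given the position of one
block, the degree of this block in H_s has mean at least
(beta + gamma) C(m-1, q-1), and a transposition changes it by O(C(m-1, q-1) / n)
only, so that it is concentrated with exponentially small error probabilities
([coset_concentration], [card_bad_perms]).  Hence, for all s outside an
exponentially small proportion, all degrees of H_s are almost as large as their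
means, and the definition of beta provides a fractional perfect matching y_s of
H_s whose entropy is about (m/q) ln(deg), where deg is the minimum degree of H_s.

One y_s is far from sufficient, because H_s sees few edges of G.  But a suitable
average x of the y_s is a fractional perfect matching of G, and a given edge of G
is a union of blocks only for a proportion C(m, q) / C(n, k) of the permutations:
the log-sum inequality turns this spreading into an additional entropy of
(n/k) ln(C(n, k) / C(m, q)) ([mixture_entropy], [entropy_good_perms]).  The sum of
both contributions is the required bound, because
C(m, q) = (m/q) C(m-1, q-1) and C(n, k) C(k, d) = C(n, d) C(n-d, k-d)
([averaging_constant]).

If d does not divide n, each s leaves r = n mod d vertices uncovered, and x must
still cover every vertex exactly once.  The permutations are therefore weighted in
such a way that all r-subsets of V have the same probability of being left over.
This is possible with almost uniform weights: a proportion of bad permutations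
that is exponentially small is negligible even among the permutations with a
prescribed leftover set, whose proportion is only polynomially small. *)

(** * Permutations with prescribed values outside a set *)

Section PermutationCosets.
Variable T : finType.
Implicit Types (U Q B : {set T}) (s t : {perm T}).

(** This is the coset of t modulo the pointwise stabiliser of the complement of U:
conditioning on the values of a random permutation outside U amounts to drawing
it from such a set. *)
Definition agree_off U t : {set {perm T}} :=
  [set s : {perm T} | [forall x in ~: U, s x == t x]].

Lemma agree_offP U s t :
  reflect (forall x, x \notin U -> s x = t x) (s \in agree_off U t).
Proof.
rewrite inE; apply: (iffP forall_inP) => H x.
  by move=> xU; apply/eqP/H; rewrite inE.
by rewrite inE => /H->.
Qed.

Lemma agree_off_refl U t : t \in agree_off U t.
Proof. exact/agree_offP. Qed.

Lemma agree_off_sym U s t : (s \in agree_off U t) = (t \in agree_off U s).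
Proof. by apply/idP/idP => /agree_offP H; apply/agree_offP => x xU; rewrite H. Qed.

Lemma agree_offT t : agree_off [set: T] t = [set: {perm T}].
Proof.
by apply/setP => s; rewrite [RHS]in_setT; apply/agree_offP => x; rewrite in_setT.
Qed.

Lemma card_agree_off U t : #|agree_off U t| = #|U| `!.
Proof.
rewrite -(card_perm U) -(card_imset (perm_on U) (mulIg t)); apply: eq_card => s.
apply/agree_offP/imsetP => [H|[u uU ->] x xU].
  exists (s * t^-1)%g; last by rewrite -mulgA mulVg mulg1.
  apply/subsetP => x; rewrite inE; apply: contraNT => xU.
  by rewrite permM H// permK.
by rewrite permM (out_perm uU).
Qed.

Lemma card_permT : #|[set: {perm T}]| = #|T| `!.
Proof. by rewrite -(agree_offT 1%g) card_agree_off cardsT. Qed.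

Lemma agree_off_image_mem U s t x : s \in agree_off U t ->
  (s x \in t @: U) = (x \in U).
Proof.
move=> /agree_offP H; apply/idP/idP => [/imsetP[y yU sxty]|xU].
  apply: contraTT yU => xU; rewrite H// in sxty.
  by rewrite -(perm_inj sxty).
have -> : s x = t (t^-1 (s x))%g by rewrite permKV.
apply: imset_f; apply: contraT => zU.
by move: (H _ zU); rewrite permKV => /perm_inj zx; rewrite zx xU in zU.
Qed.

(** Revealing the value at x of a random element of the coset: the value is t y
for a uniform y in U, and composing with the transposition of x and y gives a
representative of the smaller coset. *)
Lemma agree_off_split (M : nmodType) U t x (F : {perm T} -> M) : x \in U ->
  \sum_(s in agree_off U t) F s =
  \sum_(y in U) \sum_(s in agree_off (U :\ x) (tperm x y * t)%g) F s.
Proof.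
move=> xU; rewrite (partition_big (fun s => (t^-1)%g (s x)) (mem U)) /=; last first.
  move=> s sC; rewrite -(mem_imset _ _ (@perm_inj _ t)) permKV.
  by rewrite (agree_off_image_mem _ sC).
apply: eq_bigr => y yU; apply: eq_bigl => s.
apply/andP/agree_offP => [[/agree_offP H /eqP E] z|H].
  rewrite !inE negb_and negbK permM => /orP[/eqP->|zU].
    by rewrite tpermL -E permKV.
  rewrite tpermD ?H//; first by apply: contraNneq zU => <-.
  by apply: contraNneq zU => <-.
split; last by rewrite H ?inE ?eqxx// permM tpermL permK.
apply/agree_offP => z zU; rewrite H ?inE ?(negPf zU) ?andbF// permM tpermD//.
  by apply: contraNneq zU => <-.
by apply: contraNneq zU => <-.
Qed.

(** Compose transpositions that each bring one more element of B' into the image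
of B. *)
Lemma perm_move_set B B' : #|B| = #|B'| ->
  exists2 u : {perm T}, perm_on (B :|: B') u & u @: B = B'.
Proof.
have [n] := ubnP #|B :\: B'|; elim: n => // n IH in B * => lt_n eqB.
have [BB'|/set0Pn[a aB]] := eqVneq (B :\: B') set0.
  exists 1%g; first exact: perm_on1.
  rewrite (eq_imset _ (@perm1 T)) imset_id; apply/eqP.
  by rewrite eqEcard eqB leqnn andbT -setD_eq0 BB'.
have : (0 < #|B' :\: B|)%N.
  have : (0 < #|B :\: B'|)%N by rewrite card_gt0; apply/set0Pn; exists a.
  by rewrite !cardsD eqB finset.setIC.
rewrite card_gt0 => /set0Pn[b]; rewrite inE => /andP[bB bB'].
move: aB; rewrite inE => /andP[aB' aB].
have tE z : (z \in tperm a b @: B) = (tperm a b z \in B).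
  by rewrite -{1}(tpermK a b z) mem_imset//; exact: perm_inj.
have [||u uon uB] := IH (tperm a b @: B).
- apply: leq_ltn_trans (_ : #|(B :\: B') :\ a| < n)%N.
    apply/subset_leq_card/subsetP => z; rewrite !inE tE => /andP[].
    case: tpermP => [->|->|/eqP za zb zB' zB]; rewrite ?(negPf bB) ?bB' //.
    by rewrite za zB' zB.
  have := cardsD1 a (B :\: B'); rewrite inE aB' aB /= => E.
  by move: lt_n; rewrite E add1n ltnS.
- by rewrite card_imset//; exact: perm_inj.
exists (tperm a b * u)%g; last first.
  rewrite -uB -imset_comp; apply: eq_imset => z /=; exact: permM.
apply/subsetP => z; rewrite inE; apply: contraNT.
rewrite inE negb_or => /andP[zB zB']; rewrite permM tpermD; last 2 first.
- by apply: contraNneq zB => <-.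
- by apply: contraNneq zB' => <-.
apply/eqP; apply: (out_perm uon); rewrite inE negb_or zB' andbT tE tpermD//.
  by apply: contraNneq zB => <-.
by apply: contraNneq zB' => <-.
Qed.

(** The image of a fixed set Q is uniform among the subsets of t @: U of the size of
Q, because any two of these are exchanged by a permutation that fixes the
complement of t @: U, and composing with it preserves the coset. *)
Lemma uniform_image U t Q B : Q \subset U -> B \subset t @: U -> #|B| = #|Q| ->
  (#|[set s : {perm T} in agree_off U t | s @: Q == B]| * 'C(#|U|, #|Q|))%N = #|U| `!.
Proof.
move=> QU BU cB.
rewrite -[in 'C(_, _)](card_imset U (@perm_inj _ t)) -cards_draws mulnC -sum_nat_const.
rewrite (eq_bigr (fun B' : {set T} =>
  #|[set s : {perm T} in agree_off U t | s @: Q == B']|)); last first.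
  move=> B'; rewrite inE => /andP[BU' /eqP cB'].
  have [u uon uB] := @perm_move_set B B' (etrans cB (esym cB')).
  rewrite -(card_imset _ (mulIg u)); apply: eq_card => s.
  have C s1 : s1 \in agree_off U t -> (s1 * u)%g \in agree_off U t.
    move=> s1C; apply/agree_offP => x xU; rewrite permM (out_perm uon).
      by move/agree_offP: s1C => ->.
    by move: xU; rewrite -(agree_off_image_mem _ s1C); apply: contraNN;
       rewrite inE => /orP[]/(subsetP _ _)->.
  have V s1 : s1 \in agree_off U t -> (s1 * u^-1)%g \in agree_off U t.
    move=> s1C; apply/agree_offP => x xU; rewrite permM (out_perm (perm_onV uon)).
      by move/agree_offP: s1C => ->.
    by move: xU; rewrite -(agree_off_image_mem _ s1C); apply: contraNN;
       rewrite inE => /orP[]/(subsetP _ _)->.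
  apply/imsetP/idP => [[s1]|].
    rewrite inE => /andP[/C s1C /eqP s1Q] ->; rewrite inE s1C /=.
    rewrite -uB -s1Q -imset_comp; apply/eqP/eq_imset => z /=; exact: permM.
  rewrite inE => /andP[/V sC /eqP sQ]; exists (s * u^-1)%g; last first.
    by rewrite -mulgA mulVg mulg1.
  rewrite inE sC /= -(inj_eq (imset_inj (@perm_inj _ u))) uB -sQ -imset_comp.
  by apply/eqP/eq_imset => z /=; rewrite permM permKV.
rewrite -(card_agree_off U t) -[RHS]sum1_card.
rewrite [RHS](partition_big (fun s : {perm T} => s @: Q)
   (mem [set B' : {set T} | B' \subset t @: U & #|B'| == #|Q|])) /=; last first.
  move=> s sC; rewrite inE card_imset ?eqxx ?andbT; last exact: perm_inj.
  apply/subsetP => _ /imsetP[x xQ ->]; rewrite (agree_off_image_mem _ sC).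
  exact: (subsetP QU).
by apply: eq_bigr => B' _; rewrite -sum1dep_card.
Qed.

End PermutationCosets.

(** * Concentration for functions of a random permutation *)

Section Concentration.
Variable R : realType.

Lemma expR_le_quadratic (x : R) : x <= 2^-1 -> expR x <= 1 + x + 2 * x ^+ 2.
Proof.
move=> x12; have lt0 : 0 < 1 - x by lra.
have := expR_ge1Dx (- x); rewrite expRN => le1.
have le2 : expR x <= (1 - x)^-1.
  by rewrite -[expR x]invrK lef_pV2// posrE invr_gt0 expR_gt0.
apply: (le_trans le2); rewrite -[leLHS]mul1r ler_pdivrMr//.
have -> : (1 + x + 2 * x ^+ 2) * (1 - x) = 1 + x ^+ 2 * (1 - 2 * x) by ring.
by rewrite lerDl mulr_ge0// ?sqr_ge0//; lra.
Qed.

(** A weak form of Hoeffding's lemma: the linear terms cancel in the sum, and the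
quadratic ones are at most 2 (lam c)^2. *)
Lemma sum_expR_deviation (I : finType) (A : {set I}) (M : I -> R) (c lam : R) :
  (0 < #|A|)%N -> 0 <= lam -> lam * c <= 2^-1 ->
  (forall i j, i \in A -> j \in A -> M i <= M j + c) ->
  \sum_(i in A) expR (lam * ((\sum_(j in A) M j) / #|A|%:R - M i)) <=
    #|A|%:R * expR (2 * (lam * c) ^+ 2).
Proof.
move=> A0 l0 lc Mc; set mu := _ / _.
have A0' : 0 < #|A|%:R :> R by rewrite ltr0n.
have sumA (a : R) : \sum_(i in A) a = #|A|%:R * a by rewrite sumr_const mulr_natl.
have dev i : i \in A -> `|mu - M i| <= c.
  move=> iA; have le1 : #|A|%:R * mu <= #|A|%:R * (M i + c).
    rewrite -[leRHS]sumA /mu mulrC divfK ?gt_eqF//.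
    by apply: ler_sum => j jA; exact: Mc.
  have le2 : #|A|%:R * (M i - c) <= #|A|%:R * mu.
    rewrite -[leLHS]sumA /mu [leRHS]mulrC divfK ?gt_eqF//.
    by apply: ler_sum => j jA; rewrite lerBlDr; exact: Mc.
  by move: le1 le2; rewrite !ler_pM2l// ler_norml; lra.
have sum0 : \sum_(i in A) (mu - M i) = 0.
  by rewrite sumrB sumA /mu mulrC divfK ?gt_eqF// subrr.
apply: (@le_trans _ _ (\sum_(i in A) (1 + lam * (mu - M i) + 2 * (lam * c) ^+ 2))).
  apply: ler_sum => i iA; have /= := dev i iA; rewrite ler_norml => /andP[d1 d2].
  have le1 : lam * (mu - M i) <= lam * c by rewrite ler_wpM2l.
  have le2 : - (lam * c) <= lam * (mu - M i) by rewrite -mulrN ler_wpM2l.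
  apply: (le_trans (expR_le_quadratic (le_trans le1 lc))).
  rewrite lerD2l ler_pM2l//; nra.
rewrite 2!big_split /= -mulr_sumr sum0 mulr0 addr0 !sumA -mulrDr ler_pM2l//.
exact: expR_ge1Dx.
Qed.

Variable T : finType.
Implicit Types (U : {set T}) (s t : {perm T}).

(** An Azuma inequality, proved by revealing the values of s on U one at a time.
The cosets for two possible values of s at x are matched by composition with a
transposition, so that their means differ by at most c; each step therefore costs
a factor exp (2 (lam c)^2) by [sum_expR_deviation]. *)
Lemma coset_concentration U t (f : {perm T} -> R) (c lam : R) :
  0 <= lam -> lam * c <= 2^-1 ->
  (forall s x y, s \in agree_off U t -> x \in U -> y \in U ->
     f (tperm x y * s)%g <= f s + c) ->
  \sum_(s in agree_off U t)
     expR (lam * ((\sum_(s' in agree_off U t) f s') / #|U| `!%:R - f s)) <=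
  #|U| `!%:R * expR (2 * #|U|%:R * (lam * c) ^+ 2).
Proof.
move=> l0 lc; have [n cU] : exists n, #|U| = n by exists #|U|.
elim: n => [|n IH] in U t cU *; move=> fc.
  have -> : agree_off U t = [set t].
    apply/esym/eqP; rewrite eqEcard cards1 card_agree_off cU andbT sub1set.
    exact: agree_off_refl.
  by rewrite !big_set1 cU fact0 divr1 subrr !mulr0 mul0r expR0 mul1r.
have [x xU] : exists x, x \in U by apply/set0Pn; rewrite -card_gt0 cU.
pose V := U :\ x; have cV : #|V| = n.
  by have := cardsD1 x U; rewrite xU cU => -[].
pose C y := agree_off V (tperm x y * t)%g.
pose M y := (\sum_(s in C y) f s) / n`!%:R.
have n0 : 0 < n`!%:R :> R by rewrite ltr0n fact_gt0.
have CU y s : y \in U -> s \in C y -> s \in agree_off U t.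
  move=> yU /agree_offP H; apply/agree_offP => z zU.
  rewrite H ?inE ?(negPf zU) ?andbF// permM tpermD//.
    by apply: contraNneq zU => <-.
  by apply: contraNneq zU => <-.
have CE y s : s \in C y -> s x = t y.
  by move=> /agree_offP->; rewrite ?inE ?eqxx// permM tpermL.
(* Exchanging the values t y and t z is the bijection between the two cosets. *)
have CyCz y z s : y \in U -> z \in U -> s \in C y ->
    (s * tperm (t y) (t z))%g \in C z.
  move=> yU zU sC; apply/agree_offP => w; rewrite !inE negb_and negbK permM.
  have [-> _|wx /= wU] := eqVneq w x.
    by rewrite (CE _ _ sC) tpermL permM tpermL.
  have /agree_offP-> // := CU _ _ yU sC.
  have wE v : v \in U -> v != w by move=> vU; apply: contraNneq wU => <-.
  by rewrite permM !tpermD// ?(inj_eq perm_inj) ?wE// eq_sym.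
have sumC y (a : R) : \sum_(s in C y) a = n`!%:R * a.
  by rewrite sumr_const card_agree_off cV mulr_natl.
have muE : (\sum_(s in agree_off U t) f s) / #|U| `!%:R = (\sum_(y in U) M y) / #|U|%:R.
  rewrite (agree_off_split _ _ xU) -mulr_suml cU factS natrM invfM mulrA.
  by rewrite [in RHS]mulrAC.
have MM y z : y \in U -> z \in U -> M y <= M z + c.
  move=> yU zU; rewrite /M -(ler_pM2r n0) mulrDl !divfK ?gt_eqF//.
  rewrite [c * _]mulrC -(sumC z) -big_split /=.
  pose u := tperm (t y) (t z).
  rewrite (reindex_inj (mulIg u)) /=.
  have Cu s : ((s * u)%g \in C y) = (s \in C z).
    apply/idP/idP => [/(CyCz _ _ _ yU zU)|/(CyCz _ _ _ zU yU)]; last by rewrite tpermC.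
    by rewrite -mulgA tperm2 mulg1.
  rewrite (eq_bigl _ _ Cu); apply: ler_sum => s sC.
  have sU := CU z s zU sC.
  have [w wU sw] : exists2 w, w \in U & s w = t y.
    exists (s^-1 (t y))%g; last by rewrite permKV.
    by rewrite -(agree_off_image_mem _ sU) permKV imset_f.
  have -> : (s * u = tperm x w * s)%g.
    by rewrite /u -sw -(CE _ _ sC) -tpermJ tpermC conjgE !mulgA mulgV mul1g.
  exact: fc.
have Ey y : y \in U -> \sum_(s in C y) expR (lam * (M y - f s)) <=
    n`!%:R * expR (2 * n%:R * (lam * c) ^+ 2).
  move=> yU; have := IH V (tperm x y * t)%g cV; rewrite cV; apply.
  move=> s v w /(CU _ _ yU) sC; rewrite !inE => /andP[_ vU] /andP[_ wU].
  exact: fc.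
rewrite muE (agree_off_split _ _ xU).
set mu := _ / _.
have Sy y : y \in U ->
    \sum_(s in C y) expR (lam * (mu - f s)) <=
    expR (lam * (mu - M y)) * (n`!%:R * expR (2 * n%:R * (lam * c) ^+ 2)).
  move=> yU; apply: le_trans (ler_wpM2l (expR_ge0 _) (Ey y yU)).
  rewrite mulr_sumr; apply: ler_sum => s _; rewrite -expRD -mulrDr.
  by rewrite addrA subrK.
apply: (@le_trans _ _ _ _ _ (ler_sum _ Sy)); rewrite -mulr_suml.
have U0 : (0 < #|U|)%N by rewrite cU.
have := sum_expR_deviation U0 l0 lc MM; rewrite -/mu => le1.
apply: le_trans (ler_wpM2r _ le1) _; first by rewrite mulr_ge0// ?expR_ge0.
rewrite cU factS natrM (_ : 2 * n.+1%:R * (lam * c) ^+ 2 =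
  2 * (lam * c) ^+ 2 + 2 * n%:R * (lam * c) ^+ 2); last by rewrite -natr1; ring.
by rewrite expRD mulrACA.
Qed.
End Concentration.

(** * The hypergraph induced on the blocks *)

Lemma setD_inj (T : finType) (D I J : {set T}) :
  D \subset I -> D \subset J -> I :\: D = J :\: D -> I = J.
Proof.
by move=> DI DJ eIJ; rewrite -(setID I D) -(setID J D) eIJ (setIidPr DI) (setIidPr DJ).
Qed.

Lemma card_supersets (T : finType) (j : nat) (D : {set T}) : (#|D| <= j)%N ->
  #|[set I : {set T} | (#|I| == j) && (D \subset I)]| = 'C(#|T| - #|D|, j - #|D|).
Proof.
move=> Dj; have -> : (#|T| - #|D|)%N = #|~: D| by rewrite -(cardsC D) addKn.
rewrite -cards_draws -(card_in_imset (f := fun I => I :\: D)).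
  apply: eq_card => J; rewrite inE; apply/imsetP/andP => [[I]|[JD /eqP cJ]].
    rewrite inE => /andP[/eqP cI DI] ->; rewrite setDE subsetIr; split=> //.
    by rewrite -setDE cardsD (setIidPr DI) cI.
  have JD0 : J :&: D = set0 by apply/disjoint_setI0; rewrite disjoints_subset.
  exists (J :|: D); last first.
    by rewrite setDUl setDv setU0 setDE; apply/esym/setIidPl.
  by rewrite inE subsetUr cardsU JD0 cards0 subn0 cJ subnK ?eqxx.
by move=> I J; rewrite !inE => /andP[_ DI] /andP[_ DJ]; exact: setD_inj.
Qed.

Section Blocks.
Variables (V W : finType) (d : nat).
Implicit Types (h : W * 'I_d -> V) (I J : {set W}).

(** An injective h : W * 'I_d -> V encodes disjoint blocks of d vertices of V
indexed by W; blocks h I is the union of those indexed by I. *)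
Definition blocks h I : {set V} := [set h p | p in [set p | p.1 \in I]].

Lemma mem_blocks h I p : injective h -> (h p \in blocks h I) = (p.1 \in I).
Proof. by move=> hI; rewrite /blocks mem_imset// inE. Qed.

Lemma card_blocks h I : injective h -> #|blocks h I| = (#|I| * d)%N.
Proof.
move=> hI; rewrite card_imset// (_ : [set p | _] = setX I [set: 'I_d]).
  by rewrite cardsX cardsT card_ord.
by apply/setP => p; rewrite !inE andbT.
Qed.

Lemma blocksS h I J : I \subset J -> blocks h I \subset blocks h J.
Proof.
move=> IJ; apply: imsetS; apply/subsetP => p; rewrite !inE; exact: (subsetP IJ).
Qed.

Lemma blocksD h I J : injective h -> blocks h (I :\: J) = blocks h I :\: blocks h J.
Proof.
move=> hI; apply/setP => v; apply/imsetP/setDP => [[p]|[/imsetP[p pI ->]]].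
  by rewrite !inE => /andP[pJ pI] ->; rewrite !mem_blocks.
by rewrite mem_blocks// => pJ; exists p => //; move: pI; rewrite !inE => ->; rewrite pJ.
Qed.

Lemma blocks_comp h (s : {perm V}) I : blocks (s \o h) I = s @: blocks h I.
Proof. by rewrite /blocks -imset_comp. Qed.

Variables (k q : nat).
Implicit Types (G : uhypergraph k V).

Lemma block_edges_card G h :
  {in [set I : {set W} | (#|I| == q) && (blocks h I \in edges G)],
    forall I : {set W}, #|I| = q}.
Proof. by move=> I; rewrite inE => /andP[/eqP]. Qed.

Definition block_hypergraph G h : uhypergraph q W :=
  UHypergraph (@block_edges_card G h).

Lemma mem_block_hypergraph G h I :
  (I \in edges (block_hypergraph G h)) = (#|I| == q) && (blocks h I \in edges G).
Proof. by rewrite inE. Qed.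

Lemma block_edge_mem_edges G h I : I \in edges (block_hypergraph G h) ->
  blocks h I \in edges G.
Proof. by rewrite mem_block_hypergraph => /andP[]. Qed.

Lemma deg_block_hypergraphE G h i : deg (block_hypergraph G h) [set i] =
  (\sum_(I in [set I : {set W} | (#|I| == q) && ([set i] \subset I)])
     (blocks h I \in edges G))%N.
Proof.
rewrite /deg -sum1_card [RHS]big_mkcond [LHS]big_mkcond; apply: eq_bigr => I _.
by rewrite !inE; case: eqP; case: (_ \subset _); case: (_ \in _).
Qed.

Hypotheses (qd : (q * d)%N = k) (q_gt1 : (1 < q)%N) (d_gt0 : (0 < d)%N).
Variables (G : uhypergraph k V) (g : W * 'I_d -> V).
Hypothesis g_inj : injective g.

Let U i := ~: blocks g [set i].

Lemma card_coblock i : #|U i| = (#|V| - d)%N.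
Proof.
have := cardsC (blocks g [set i]).
by rewrite card_blocks// cards1 mul1n => <-; rewrite addKn.
Qed.

(** Once the block of i is placed, the union of the other blocks of I is a uniform
(k-d)-subset of the remaining vertices by [uniform_image], so that it completes
the block to an edge with probability deg / C(n-d, k-d). *)
Lemma sum_edge_block_hypergraph (t : {perm V}) i I : #|I| = q -> [set i] \subset I ->
  ((\sum_(s in agree_off (U i) t) (blocks (s \o g) I \in edges G)) *
    'C(#|V| - d, k - d) = deg G (t @: blocks g [set i]) * #|U i| `!)%N.
Proof.
move=> cI iI; set A := t @: _.
have AE s : s \in agree_off (U i) t -> s @: blocks g [set i] = A.
  move=> /agree_offP sC; apply: eq_in_imset => v vi; apply: sC.
  by rewrite inE negbK.
have cA : #|A| = d by rewrite card_imset ?card_blocks ?cards1 ?mul1n//; exact: perm_inj.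
have cI' : #|blocks g (I :\: [set i])| = (k - d)%N.
  by rewrite card_blocks// cardsD (setIidPr iI) cards1 cI mulnBl qd mul1n.
transitivity (\sum_(e in [set e in edges G | A \subset e])
   #|[set s : {perm V} in agree_off (U i) t |
        s @: blocks g (I :\: [set i]) == e :\: A]| * 'C(#|V| - d, k - d))%N; last first.
  rewrite /deg -sum_nat_const; apply: eq_bigr => e.
  rewrite inE => /andP[eG Ae]; rewrite -(card_coblock i) -cI'.
  rewrite uniform_image// ?cI'.
  - by rewrite blocksD// setDE subsetIr.
  - apply/subsetP => v; rewrite inE => /andP[vA _]; apply: contraR vA => vU.
    rewrite -[v](permKV t) mem_imset; last exact: perm_inj.
    apply: contraR vU => vi; rewrite -[v](permKV t) imset_f// inE.
    exact: vi.
  - by rewrite cardsD (setIidPr Ae) (edges_card eG) cA.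
rewrite -big_distrl /=; congr (_ * _)%N.
under [RHS]eq_bigr => e _ do rewrite -sum1_card.
rewrite (exchange_big_dep (mem (agree_off (U i) t))) /=; last first.
  by move=> e s _; rewrite inE => /andP[].
apply: eq_bigr => s sC; rewrite blocks_comp.
have As : A \subset s @: blocks g I by rewrite -(AE s sC); exact/imsetS/blocksS.
have sE : s @: blocks g (I :\: [set i]) = s @: blocks g I :\: A.
  rewrite blocksD// -(AE s sC); apply/setP => v.
  by rewrite -(permKV s v) inE !(mem_imset _ _ (@perm_inj _ s)) inE.
have sCe B e : (s \in [set s : {perm V} in agree_off (U i) t | s @: B == e]) =
    (s @: B == e) by rewrite in_set sC.
under eq_bigl => e do rewrite sCe sE.
rewrite sum1dep_card.
have [sG|sG] := boolP (_ \in edges G).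
  rewrite (_ : [set _ | _] = [set s @: blocks g I]) ?cards1//.
  apply/setP => e; rewrite !inE.
  apply/idP/eqP => [/andP[/andP[eG Ae] /eqP E]|->]; last first.
    by rewrite sG As eqxx.
  exact: setD_inj Ae As (esym E).
apply/esym/eqP; rewrite cards_eq0; apply/eqP/setP => e; rewrite !inE.
apply/negP => /andP[/andP[eG Ae] /eqP E]; case/negP: sG.
by rewrite (setD_inj As Ae E).
Qed.

(** The mean degree of i in the block hypergraph, once the block of i is placed. *)
Lemma sum_deg_block_hypergraph (t : {perm V}) i :
  ((\sum_(s in agree_off (U i) t) deg (block_hypergraph G (s \o g)) [set i]) *
    'C(#|V| - d, k - d) =
  deg G (t @: blocks g [set i]) * 'C(#|W| - 1, q - 1) * #|U i| `!)%N.
Proof.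
under eq_bigr => s _ do rewrite deg_block_hypergraphE.
rewrite exchange_big /= big_distrl /=.
rewrite (eq_bigr (fun=> (deg G (t @: blocks g [set i]) * #|U i| `!)%N)); last first.
  move=> I; rewrite inE => /andP[/eqP cI iI]; exact: sum_edge_block_hypergraph.
rewrite sum_nat_const card_supersets cards1 ?(ltnW q_gt1)//.
by rewrite mulnCA mulnA.
Qed.

(** Exchanging the images of x and y affects only the sets I whose blocks contain
x or y, and these contain a second prescribed index in addition to i. *)
Lemma deg_block_hypergraph_swap (s : {perm V}) i x y : x \in U i -> y \in U i ->
  (deg (block_hypergraph G ((tperm x y * s)%g \o g)) [set i] <=
   deg (block_hypergraph G (s \o g)) [set i] + 2 * 'C(#|W| - 2, q - 2))%N.
Proof.
pose D z := [set I : {set W} | [&& #|I| == q, [set i] \subset I & z \in blocks g I]].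
have cD z : z \in U i -> (#|D z| <= 'C(#|W| - 2, q - 2))%N.
  move=> zU; have [/imsetP[[j l] _ zE]|zN] := boolP (z \in blocks g setT); last first.
    rewrite (_ : D z = set0) ?cards0//; apply/setP => I; rewrite !inE.
    apply/negP => /and3P[_ _ zI]; case/negP: zN.
    exact: (subsetP (blocksS _ (subsetT I))).
  have ij : i != j.
    by apply: contraTneq zU => ->; rewrite inE negbK zE mem_blocks// inE.
  have c2 : #|[set i; j]| = 2%N by rewrite cards2 ij.
  rewrite -c2 -card_supersets ?c2//; apply/subset_leq_card/subsetP => I.
  by rewrite !inE zE mem_blocks//= subUset !sub1set => /and3P[-> -> ->].
move=> xU yU; rewrite mul2n -addnn addnA.
apply: leq_trans (leq_add (leq_add (leqnn _) (cD x xU)) (cD y yU)).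
rewrite /deg; set S := [set I in edges (block_hypergraph G (s \o g)) | _].
have : (#|S :|: D x :|: D y| <= #|S| + #|D x| + #|D y|)%N.
  apply: (leq_trans (leq_card_setU _ _).1); rewrite leq_add2r.
  exact: (leq_card_setU _ _).1.
apply: leq_trans; rewrite {}/S.
apply/subset_leq_card/subsetP => I; rewrite !inE => /andP[/andP[/eqP cI]].
rewrite cI eqxx !blocks_comp /= => sIG ->; rewrite andbT.
have [xI|xI] := boolP (x \in blocks g I); first by rewrite orbT.
have [yI|yI] := boolP (y \in blocks g I); first by rewrite !orbT.
rewrite !orbF; suff -> : s @: blocks g I = (tperm x y * s)%g @: blocks g I by [].
apply: eq_in_imset => v vI.
rewrite permM tpermD//; first by apply: contraNneq xI => ->.
by apply: contraNneq yI => ->.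
Qed.

End Blocks.

(** * Entropy of a mixture of fractional perfect matchings *)

Section LogSum.
Variable R : realType.

(** The convex function y ln y lies above its tangent at t. *)
Lemma tangent_xlnx (y t : R) : 0 <= y -> 0 < t -> y * ln t + y - t <= y * ln y.
Proof.
move=> y0 t0; have [->|yn0] := eqVneq y 0; first by rewrite !mul0r !add0r oppr_le0 ltW.
have {y0 yn0} y0 : 0 < y by rewrite lt_neqAle eq_sym yn0.
have ty : 0 < t / y by rewrite divr_gt0.
have := @le_ln1Dx R (t / y - 1); rewrite [1 + _]addrC subrK => /(_ _)/wrap[].
  by lra.
rewrite ln_div ?posrE// => le1.
have := ler_wpM2l (ltW y0) le1; rewrite !mulrBr mulrCA divff ?gt_eqF// !mulr1.
lra.
Qed.

(** The log-sum inequality, with an upper bound W0 in place of the total weight: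
sum the tangent inequalities at t = s / W0, where s is the weighted sum of the
y j. The error term s - t * (total weight) is then nonnegative. *)
Lemma log_sum (J : finType) (P : pred J) (w y : J -> R) (W0 : R) :
  (forall j, P j -> 0 <= w j) -> (forall j, P j -> 0 < w j -> 0 <= y j) ->
  0 < W0 -> \sum_(j | P j) w j <= W0 ->
  (\sum_(j | P j) w j * y j) * ln (\sum_(j | P j) w j * y j) <=
  \sum_(j | P j) w j * (y j * ln (y j)) + (\sum_(j | P j) w j * y j) * ln W0.
Proof.
move=> w0 y0 W0gt wW; set s := \sum_(j | P j) w j * y j.
have wy0 j : P j -> 0 <= w j * y j.
  move=> Pj; have [->|wn0] := eqVneq (w j) 0; first by rewrite mul0r.
  by rewrite mulr_ge0 ?w0 ?y0// lt_neqAle eq_sym wn0 w0.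
have [s0|sn0] := eqVneq s 0.
  rewrite s0 !mul0r addr0; apply: sumr_ge0 => j Pj.
  by rewrite mulrA (psumr_eq0P wy0 s0 Pj) mul0r.
have s0 : 0 < s by rewrite lt_neqAle eq_sym sn0 sumr_ge0.
have t0 : 0 < s / W0 by rewrite divr_gt0.
have : \sum_(j | P j) w j * (y j * ln (s / W0) + y j - s / W0) <=
    \sum_(j | P j) w j * (y j * ln (y j)).
  apply: ler_sum => j Pj; have [->|wn0] := eqVneq (w j) 0; first by rewrite !mul0r.
  have wj0 : 0 < w j by rewrite lt_neqAle eq_sym wn0 w0.
  by rewrite ler_pM2l// tangent_xlnx// y0.
have E t : \sum_(j | P j) w j * (y j * ln t + y j - t) =
    s * ln t + s - (\sum_(j | P j) w j) * t.
  rewrite !mulr_suml -sumrN -!big_split /=; apply: eq_bigr => j _.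
  by rewrite mulrBr mulrDr mulrA.
rewrite E ln_div ?posrE//.
have : (\sum_(j | P j) w j) * (s / W0) <= W0 * (s / W0) by rewrite ler_wpM2r// ltW.
rewrite [W0 * _]mulrC divfK ?gt_eqF//; lra.
Qed.

End LogSum.

Section Mixture.
Variables (R : realType) (k : nat) (V : finType) (G : uhypergraph k V).

Lemma fpm_total_weight (x : {set V} -> R) :
  (forall v : V, \sum_(e in edges G | v \in e) x e = 1) ->
  k%:R * \sum_(e in edges G) x e = #|V|%:R.
Proof.
move=> x1; transitivity (\sum_(v : V) \sum_(e in edges G | v \in e) x e); last first.
  by under eq_bigr => v _ do rewrite x1; rewrite sumr_const.
rewrite (exchange_big_dep (mem (edges G))) => [|v e _ /andP[]//] /=.
rewrite mulr_sumr; apply: eq_bigr => e eG.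
rewrite (eq_bigl (mem e)) => [|v]; last by rewrite eG.
by rewrite sumr_const (edges_card eG) mulr_natl.
Qed.

Variables (q : nat) (W Om : finType) (H : Om -> uhypergraph q W).
Variables (phi : Om -> {set W} -> {set V}) (w : Om -> R) (y : Om -> {set W} -> R).

(** The average with weights w of the transports of the y om along phi om. *)
Definition mixture (e : {set V}) : R :=
  \sum_(p : Om * {set W} | (p.2 \in edges (H p.1)) && (phi p.1 p.2 == e))
     w p.1 * y p.1 p.2.

Lemma sum_mixture (P : pred {set V}) (F : Om * {set W} -> R) :
  (forall om I, I \in edges (H om) -> phi om I \in edges G) ->
  \sum_(e in edges G | P e)
    \sum_(p : Om * {set W} | (p.2 \in edges (H p.1)) && (phi p.1 p.2 == e)) F p =
  \sum_om \sum_(I in edges (H om) | P (phi om I)) F (om, I).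
Proof.
move=> HG; rewrite [RHS]pair_big_dep /=.
rewrite (exchange_big_dep
  (fun p : Om * {set W} => (p.2 \in edges (H p.1)) && P (phi p.1 p.2))) /=; last first.
  by move=> e p /andP[_ Pe] /andP[-> /eqP->].
apply: eq_big => [[om I] //| [om I] /= /andP[oI PI]].
rewrite (big_pred1 (phi om I))// => e /=; rewrite oI /= eq_sym.
by case: (eqVneq e (phi om I)) => [->|_]; rewrite ?andbF // HG // PI.
Qed.

Hypothesis k_gt0 : (0 < k)%N.
Hypothesis phi_edge : forall om I, I \in edges (H om) -> phi om I \in edges G.
Hypothesis w_ge0 : forall om, 0 <= w om.
Hypothesis y_fpm : forall om, 0 < w om -> fractional_perfect_matching (H om) (y om).
Hypothesis cover : forall v,
  \sum_om w om * (\sum_(I in edges (H om) | v \in phi om I) y om I) = 1.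

Lemma mixture_fpm : fractional_perfect_matching G mixture.
Proof.
have x0 e : 0 <= mixture e.
  apply: sumr_ge0 => -[om I] /= /andP[oI _].
  have [->|wn0] := eqVneq (w om) 0; first by rewrite mul0r.
  have w0 : 0 < w om by rewrite lt_neqAle eq_sym wn0 w_ge0.
  by rewrite mulr_ge0//; have [/(_ _ oI)/andP[]] := y_fpm w0.
have x1 v : \sum_(e in edges G | v \in e) mixture e = 1.
  rewrite (sum_mixture (fun e => v \in e) (fun p => w p.1 * y p.1 p.2) phi_edge).
  by rewrite -(cover v); apply: eq_bigr => om _; rewrite mulr_sumr.
split=> // e eG; rewrite x0 /=.
have /card_gt0P[v ve] : (0 < #|e|)%N by rewrite (edges_card eG).
rewrite -(x1 v) (bigD1 e) ?eG//= lerDl; exact: sumr_ge0.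
Qed.

(** If every edge of G receives at most the weight W0, averaging increases the
entropy by at least - ln W0 per unit of weight: apply [log_sum] at each edge. *)
Lemma mixture_entropy (W0 : R) : 0 < W0 ->
  (forall e, e \in edges G ->
    \sum_(p : Om * {set W} | (p.2 \in edges (H p.1)) && (phi p.1 p.2 == e))
      w p.1 <= W0) ->
  \sum_om w om * entropy (H om) (y om) - #|V|%:R / k%:R * ln W0 <= entropy G mixture.
Proof.
move=> W0gt wW.
have kn0 : k%:R != 0 :> R by rewrite pnatr_eq0 -lt0n.
have -> : #|V|%:R / k%:R = \sum_(e in edges G) mixture e.
  have [_ x1] := mixture_fpm.
  by rewrite -(fpm_total_weight x1) mulrC mulKf.
have -> : \sum_om w om * entropy (H om) (y om) = - \sum_(e in edges G)
    \sum_(p : Om * {set W} | (p.2 \in edges (H p.1)) && (phi p.1 p.2 == e))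
      w p.1 * (y p.1 p.2 * ln (y p.1 p.2)).
  rewrite [in RHS](eq_bigl (fun e => (e \in edges G) && xpredT e)) => [|e]; last first.
    by rewrite andbT.
  rewrite (sum_mixture xpredT (fun p => w p.1 * (y p.1 p.2 * ln (y p.1 p.2))) phi_edge).
  rewrite -sumrN; apply: eq_bigr => om _; rewrite /entropy mulrN mulr_sumr.
  by congr (- _); apply: eq_bigl => I; rewrite andbT.
rewrite mulr_suml -opprD -big_split lerN2 /=; apply: ler_sum => e eG.
apply: log_sum => //; last exact: wW.
by move=> -[om I] /= /andP[oI _] w0; have [/(_ _ oI)/andP[]] := y_fpm w0.
Qed.

End Mixture.

(** * Permutations whose block hypergraph has a small degree *)

Section BadPermutations.
Variables (R : realType) (V W : finType) (d k q : nat).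
Hypotheses (qd : (q * d)%N = k) (q_gt1 : (1 < q)%N) (d_gt0 : (0 < d)%N).
Hypotheses (qW : (q <= #|W|)%N) (VW : (#|V| <= 3 * d * (#|W| - 1))%N).
Hypothesis kV : (k <= #|V|)%N.
Variables (G : uhypergraph k V) (g : W * 'I_d -> V).
Hypothesis g_inj : injective g.
Variables (rho eta : R).
Hypothesis deg_ge : forall A : {set V}, #|A| = d ->
  rho * 'C(#|V| - d, k - d)%:R <= (deg G A)%:R.
Hypotheses (eta_gt0 : 0 < eta) (eta_le1 : eta <= 1).

Definition bad_perms (i : W) : {set {perm V}} :=
  [set s : {perm V} | (deg (block_hypergraph q G (s \o g)) [set i])%:R <
    (rho - eta) * 'C(#|W| - 1, q - 1)%:R].

Let n := #|V|.
Let m := #|W|.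
Let D : R := 'C(m - 1, q - 1)%:R.
Let c : R := (2 * 'C(m - 2, q - 2))%:R.
(* With lam = sigma n / D and c <= 6 k D / n, the exponent in the concentration
   bound is at most 72 sigma^2 k^2 n, against a gain of sigma eta n; this choice
   of sigma makes the former half of the latter. *)
Let sigma := eta / (144 * k%:R ^+ 2).
Let lam := sigma * n%:R / D.
Let k_gt0 : (0 < k)%N. Proof. by rewrite -qd muln_gt0 (ltnW q_gt1). Qed.
Let D_gt0 : 0 < D. Proof. by rewrite ltr0n bin_gt0 leq_sub2r. Qed.
Let kR_ge1 : 1 <= k%:R :> R. Proof. by rewrite (ler_nat R 1). Qed.
Let kR_gt0 : 0 < k%:R :> R. Proof. by rewrite ltr0n. Qed.
Let sigma_gt0 : 0 < sigma.
Proof. by rewrite divr_gt0// mulr_gt0// exprn_gt0. Qed.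

Let lam_ge0 : 0 <= lam.
Proof. by apply: divr_ge0; [apply: mulr_ge0 => //; exact: ltW|exact: ltW]. Qed.

Let lam_c : lam * c <= eta / (24 * k%:R).
Proof.
have cD : c * (m - 1)%:R = 2 * (q - 1)%:R * D.
  rewrite /c /D -!natrM; congr (_%:R); have := mul_bin_diag (m - 1) (q - 2).
  have -> : (m - 1).-1 = (m - 2)%N by lia.
  have -> : (q - 2).+1 = (q - 1)%N by lia.
  by rewrite -!mulnA [(_ * (m - 1))%N]mulnC => ->.
have m1 : (0 < m - 1)%N by rewrite /m; lia.
have m1R : 0 < (m - 1)%:R :> R by rewrite ltr0n.
have nm : n%:R * (q - 1)%:R <= 3 * k%:R * (m - 1)%:R :> R.
  rewrite -!natrM ler_nat -qd.
  apply: leq_trans (leq_mul VW (leq_subr 1 q)) _; rewrite -/m; lia.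
have Dn0 : D != 0 by rewrite gt_eqF.
have kn0 : k%:R != 0 :> R by rewrite gt_eqF.
rewrite -(ler_pM2r m1R) -mulrA cD /lam.
have E1 (x : R) : sigma * n%:R / D * (2 * x * D) = sigma * (2 * (n%:R * x)).
  by move: (n%:R : R) sigma D Dn0 => a b e e0; field.
have E2 (x : R) : eta / (24 * k%:R) * x = sigma * (2 * (3 * k%:R * x)).
  by rewrite /sigma; move: (k%:R : R) kn0 => a a0; field.
by rewrite E1 E2 !ler_pM2l.
Qed.

(* Markov's inequality for exp (lam * (mean - degree)), once the block of i is
   placed; the swaps must leave this block in place, as moving it could change the
   degree completely. *)
Let bad_in_coset i (t : {perm V}) :
  #|agree_off (~: blocks g [set i]) t :&: bad_perms i|%:R <=
  #|agree_off (~: blocks g [set i]) t|%:R *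
     expR (- (eta ^+ 2 / (288 * k%:R ^+ 2)) * n%:R).
Proof.
set U := ~: _; set C := agree_off U t; set f := fun s : {perm V} =>
  (deg (block_hypergraph q G (s \o g)) [set i])%:R : R.
have cA : #|t @: blocks g [set i]| = d.
  by rewrite card_imset ?card_blocks ?cards1 ?mul1n//; exact: perm_inj.
have cU : #|U| = (n - d)%N by exact: card_coblock.
have U0 : 0 < #|U| `!%:R :> R by rewrite ltr0n fact_gt0.
have mu_ge : rho * D <= (\sum_(s in C) f s) / #|U| `!%:R.
  rewrite ler_pdivlMr// /f -natr_sum.
  have B0 : 0 < 'C(n - d, k - d)%:R :> R by rewrite ltr0n bin_gt0 leq_sub2r.
  rewrite -(ler_pM2r B0) -natrM (sum_deg_block_hypergraph qd q_gt1 G g_inj).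
  rewrite !natrM -/D -/U.
  have := deg_ge cA; rewrite -/n => le1.
  have := ler_wpM2r (ltW (mulr_gt0 D_gt0 U0)) le1.
  rewrite [X in X <= _ -> _](_ : _ = rho * D * #|U| `!%:R * 'C(n - d, k - d)%:R).
    by rewrite mulrA.
  by ring.
have swap s x y : s \in C -> x \in U -> y \in U -> f (tperm x y * s)%g <= f s + c.
  move=> _ xU yU; rewrite /f /c -natrD ler_nat.
  exact: deg_block_hypergraph_swap.
have lc2 : lam * c <= 2^-1.
  apply: (le_trans lam_c); rewrite ler_pdivrMr ?mulr_gt0//.
  have := kR_ge1; have := eta_le1; lra.
have := coset_concentration lam_ge0 lc2 swap; rewrite -/C.
set mu := _ / _ in mu_ge *; move=> conc.
have : #|C :&: bad_perms i|%:R * expR (lam * (eta * D)) <=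
    \sum_(s in C) expR (lam * (mu - f s)).
  rewrite mulr_natl -sumr_const.
  apply: (@le_trans _ _ (\sum_(s in C :&: bad_perms i) expR (lam * (mu - f s)))).
    apply: ler_sum => s; rewrite inE => /andP[_]; rewrite inE -/(f s) -/D => fs.
    by rewrite ler_expR ler_wpM2l//; lra.
  rewrite [leRHS](big_setID (bad_perms i)) /= lerDl.
  by apply: sumr_ge0 => s _; exact: expR_ge0.
move=> /le_trans/(_ conc).
rewrite -ler_pdivlMr ?expR_gt0// => /le_trans; apply.
rewrite -expRN card_agree_off -[leLHS]mulrA ler_pM2l// -expRD ler_expR.
have -> : lam * (eta * D) = eta ^+ 2 / (144 * k%:R ^+ 2) * n%:R.
  rewrite /lam /sigma; field. by rewrite !gt_eqF.
have : 2 * #|U|%:R * (lam * c) ^+ 2 <= 2 * n%:R * (eta / (24 * k%:R)) ^+ 2.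
  have c0 : 0 <= c by rewrite ler0n.
  have lc0 : 0 <= lam * c by rewrite mulr_ge0.
  apply: ler_pM.
  - by rewrite mulr_ge0.
  - exact: sqr_ge0.
  - by rewrite ler_pM2l// ler_nat cU leq_subr.
  - by rewrite ler_pXn2r ?nnegrE//; exact: le_trans lam_c.
rewrite (_ : 2 * n%:R * (eta / (24 * k%:R)) ^+ 2 =
   eta ^+ 2 / (144 * k%:R ^+ 2) * n%:R - eta ^+ 2 / (288 * k%:R ^+ 2) * n%:R).
  lra.
by field; rewrite !gt_eqF//; lra.
Qed.

(** Average [bad_in_coset] over all positions of the block of i. *)
Lemma card_bad_perms i : #|bad_perms i|%:R <=
  #|V| `!%:R * expR (- (eta ^+ 2 / (288 * k%:R ^+ 2)) * #|V|%:R).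
Proof.
set U := ~: blocks g [set i]; pose u := #|U| `!%:R : R.
have u0 : 0 < u by rewrite ltr0n fact_gt0.
have cC t : #|agree_off U t|%:R = u by rewrite card_agree_off.
rewrite -(ler_pM2l u0).
have -> : u * #|bad_perms i|%:R =
    \sum_(t : {perm V}) #|agree_off U t :&: bad_perms i|%:R.
  transitivity (\sum_(s in bad_perms i) #|agree_off U s|%:R : R).
    by under eq_bigr do rewrite cC; rewrite sumr_const mulr_natr.
  rewrite -!natr_sum; congr (_%:R).
  under eq_bigr do rewrite -sum1_card.
  under [RHS]eq_bigr do rewrite -sum1_card.
  rewrite (exchange_big_dep xpredT)//=; apply: eq_bigr => t _.
  by apply: eq_bigl => s; rewrite in_setI agree_off_sym andbC.
apply: (le_trans (ler_sum _ (fun t _ => bad_in_coset i t))).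
under eq_bigr do rewrite cC.
rewrite (eq_bigl (mem [set: {perm V}])) => [|t]; last by rewrite /= in_setT.
by rewrite sumr_const card_permT -[leLHS]mulr_natl mulrCA.
Qed.

End BadPermutations.

(** * Averaging over the good permutations *)

Section GoodPermutations.
Variables (R : realType) (V W : finType) (d k q : nat).
Hypotheses (qd : (q * d)%N = k) (q_gt0 : (0 < q)%N) (d_gt0 : (0 < d)%N).
Hypotheses (qW : (q <= #|W|)%N) (WV : (#|W| * d <= #|V|)%N).
Variables (G : uhypergraph k V) (g : W * 'I_d -> V).
Hypothesis g_inj : injective g.

Let n := #|V|.
Let m := #|W|.
Let r := (n - m * d)%N.
Let L : {set V} := ~: blocks g [set: W].

Variables (good : {set {perm V}}) (eps : R).
Hypotheses (eps_lt1 : eps < 1).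
Hypothesis few_bad : #|~: good|%:R * 'C(n, r)%:R <= eps * n`!%:R.

Let k_gt0 : (0 < k)%N. Proof. by rewrite -qd muln_gt0 q_gt0. Qed.
Let md_gt0 : (0 < m * d)%N.
Proof. by rewrite muln_gt0 d_gt0 andbT (leq_trans q_gt0). Qed.
Let n_gt0 : (0 < n)%N. Proof. exact: leq_trans md_gt0 WV. Qed.
Let nr : (n - r = m * d)%N. Proof. by rewrite subKn. Qed.
Let r_le : (r <= n)%N. Proof. exact: leq_subr. Qed.

Let cardL : #|L| = r.
Proof.
have := cardsC (blocks g [set: W]).
by rewrite card_blocks// cardsT -/n -/m -/L /r => <-; rewrite addKn.
Qed.

Definition leftover (s : {perm V}) : {set V} := s @: L.

Let card_leftover s : #|leftover s| = r.
Proof. by rewrite card_imset ?cardL//; exact: perm_inj. Qed.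

Definition good_leftover (S : {set V}) : {set {perm V}} :=
  [set s in good | leftover s == S].

(* few_bad is strong enough to bound the number of bad permutations with the given
   leftover set by the total number of bad permutations. *)
Let card_good_leftover (S : {set V}) : #|S| = r ->
  (1 - eps) * n`!%:R <= #|good_leftover S|%:R * 'C(n, r)%:R.
Proof.
move=> cS; pose A := [set s : {perm V} in agree_off [set: V] 1%g | s @: L == S].
have cA : (#|A| * 'C(n, r) = n`!)%N.
  have -> : 'C(n, r) = 'C(#|[set: V]|, #|L|) by rewrite cardL cardsT.
  rewrite uniform_image ?cardsT ?cardL//; apply/subsetP => v _.
  by apply/imsetP; exists v; rewrite ?inE ?perm1.
have leA : (#|A| <= #|good_leftover S| + #|~: good|)%N.
  apply: leq_trans (leq_card_setU _ _).1.
  apply/subset_leq_card/subsetP => s; rewrite /A agree_offT !inE /= => sS.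
  by rewrite sS andbT orbN.
have := few_bad; rewrite mulrBl mul1r -cA natrM.
have : #|A|%:R * 'C(n, r)%:R <= (#|good_leftover S| + #|~: good|)%:R * 'C(n, r)%:R :> R.
  by rewrite ler_wpM2r// ler_nat.
rewrite natrD mulrDl; lra.
Qed.

Let Cr : R := 'C(n.-1, r)%:R.
Let Cr_gt0 : 0 < Cr.
Proof. by rewrite ltr0n bin_gt0 -subn1; lia. Qed.

Let good_leftover_gt0 (S : {set V}) : #|S| = r -> 0 < #|good_leftover S|%:R :> R.
Proof.
move=> /card_good_leftover le1.
have C0 : 0 < 'C(n, r)%:R :> R by rewrite ltr0n bin_gt0.
rewrite -(pmulr_lgt0 _ C0); apply: lt_le_trans le1.
by rewrite mulr_gt0 ?subr_gt0// ltr0n fact_gt0.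
Qed.

(** With these weights, each r-subset of V has the same probability of being left
over, and n / (n - r) is the total weight: so each vertex is covered by blocks with
total weight 1. *)
Definition perm_weight (s : {perm V}) : R :=
  if s \in good then (#|good_leftover (leftover s)|%:R * Cr)^-1 else 0.

Let perm_weight_ge0 s : 0 <= perm_weight s.
Proof.
by rewrite /perm_weight; case: ifP => // _; rewrite invr_ge0 mulr_ge0 ?ler0n ?ltW.
Qed.

Let sum_perm_weight (P : pred {set V}) : \sum_(s | P (leftover s)) perm_weight s =
  #|[set S : {set V} | P S && (#|S| == r)]|%:R / Cr.
Proof.
rewrite (partition_big leftover
  (mem [set S : {set V} | P S && (#|S| == r)])) /=; last first.
  by move=> s Ps; rewrite inE Ps card_leftover eqxx.
rewrite mulr_natl -sumr_const; apply: eq_bigr => S; rewrite inE => /andP[PS /eqP cS].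
transitivity (\sum_(s in good_leftover S) (#|good_leftover S|%:R * Cr)^-1); last first.
  rewrite sumr_const -[LHS]mulr_natr invfM mulrAC mulVf ?mul1r// gt_eqF//.
  exact: good_leftover_gt0.
rewrite big_mkcond [RHS]big_mkcond; apply: eq_bigr => s _; rewrite inE /perm_weight.
have [->|_] := eqVneq (leftover s) S; last by rewrite !andbF.
by rewrite PS !andbT.
Qed.

Let bin_ratio : 'C(n, r)%:R / Cr = n%:R / (m * d)%:R :> R.
Proof.
have md0 : (m * d)%:R != 0 :> R by rewrite pnatr_eq0 -lt0n.
have Crn0 : Cr != 0 by rewrite gt_eqF.
apply/eqP; rewrite eqr_div//; apply/eqP.
by rewrite /Cr -!natrM mulnC -nr -mul_bin_down mulnC.
Qed.

Let total_perm_weight : \sum_s perm_weight s = n%:R / (m * d)%:R.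
Proof.
rewrite (sum_perm_weight xpredT) -bin_ratio; congr (_%:R / _).
by rewrite -card_draws; apply: eq_card => S; rewrite !inE.
Qed.

Let Wmax : R := n%:R / (m * d)%:R / ((1 - eps) * n`!%:R).

Let perm_weight_le s : perm_weight s <= Wmax.
Proof.
have e0 : 0 < (1 - eps) * n`!%:R by rewrite mulr_gt0 ?subr_gt0// ltr0n fact_gt0.
rewrite /perm_weight; case: ifP => _; last first.
  by rewrite /Wmax !mulr_ge0 ?invr_ge0 ?ler0n// ltW.
have N0 := good_leftover_gt0 (card_leftover s).
have := card_good_leftover (card_leftover s); set N := #|_|%:R in N0 * => le1.
rewrite /Wmax -bin_ratio invfM mulrC [leRHS]mulrAC [leRHS]mulrC ler_pM2l ?invr_gt0//.
by rewrite ler_pdivlMr// ler_pdivrMl.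
Qed.

Let card_placements (e : {set V}) : #|e| = k ->
  (#|[set p : {perm V} * {set W} | (#|p.2| == q) && (blocks (p.1 \o g) p.2 == e)]|
    * 'C(n, k) = 'C(m, q) * n`!)%N.
Proof.
move=> ce; rewrite -sum1dep_card.
rewrite -(pair_big_dep xpredT (fun (s : {perm V}) (I : {set W}) =>
   (#|I| == q) && (blocks (s \o g) I == e)) (fun _ _ => 1%N)) /=.
rewrite (exchange_big_dep (fun I : {set W} => #|I| == q)) /=; last first.
  by move=> s I _ /andP[].
rewrite big_distrl /= -(card_draws W q) -sum_nat_const.
rewrite [RHS](eq_bigl (fun I : {set W} => #|I| == q)); last first.
  by move=> I; rewrite inE.
apply: eq_bigr => I /eqP cI.
have cB : #|blocks g I| = k by rewrite card_blocks// cI.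
rewrite -cB -[n]cardsT -(@uniform_image _ [set: V] 1%g (blocks g I) e) ?cB//; last first.
  apply/subsetP => v _; apply/imsetP; exists v; rewrite ?inE ?perm1//.
congr (_ * _)%N; rewrite sum1dep_card; apply: eq_card => s.
by rewrite agree_offT !inE cI eqxx blocks_comp.
Qed.

Variables (y : {perm V} -> {set W} -> R) (B : R).
Hypothesis y_fpm : forall s, s \in good ->
  fractional_perfect_matching (block_hypergraph q G (s \o g)) (y s).
Hypothesis y_entropy : forall s, s \in good ->
  B <= entropy (block_hypergraph q G (s \o g)) (y s).

(** [mixture_entropy] for the good permutations. The argument of the logarithm is
the product of an upper bound on [perm_weight] with the number of pairs (s, I) for
which a given edge is the union of the blocks of I moved by s. *)
Lemma entropy_good_perms :
  ((n%:R / (m * d)%:R * B - n%:R / k%:R *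
     ln (n%:R / (m * d)%:R * ('C(m, q)%:R / 'C(n, k)%:R) / (1 - eps)))%:E
  <= hypergraph_entropy R G)%E.
Proof.
pose H (s : {perm V}) := block_hypergraph q G (s \o g).
pose phi (s : {perm V}) := blocks (s \o g).
have s_inj (s : {perm V}) : injective (s \o g) by exact: inj_comp (@perm_inj _ s) g_inj.
have phi_edge s I : I \in edges (H s) -> phi s I \in edges G.
  exact: block_edge_mem_edges.
have w_good s : 0 < perm_weight s -> s \in good.
  by rewrite /perm_weight; case: ifP; rewrite ?ltxx.
have w_fpm s : 0 < perm_weight s -> fractional_perfect_matching (H s) (y s).
  by move=> /w_good; exact: y_fpm.
have cover v :
    \sum_s perm_weight s * (\sum_(I in edges (H s) | v \in phi s I) y s I) = 1.
  transitivity (\sum_(s | v \notin leftover s) perm_weight s); last first.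
    rewrite (sum_perm_weight (fun S => v \notin S)).
    rewrite (_ : #|_| = 'C(n.-1, r)) ?divff ?gt_eqF//.
    rewrite -(cardsC1 v) -cards_draws; apply: eq_card => S; rewrite !inE; congr (_ && _).
    by rewrite subsetC sub1set inE.
  rewrite [RHS]big_mkcond; apply: eq_bigr => s _.
  have [->|wn0] := eqVneq (perm_weight s) 0; first by rewrite mul0r if_same.
  have w0 : 0 < perm_weight s by rewrite lt_neqAle eq_sym wn0 perm_weight_ge0.
  have vE : (v \in leftover s) = ((s^-1)%g v \notin blocks g [set: W]).
    by rewrite -{1}(permKV s v) /leftover mem_imset ?inE//; exact: perm_inj.
  rewrite vE negbK; case: ifPn => [/imsetP[[j l] _ gE]|vN].
    have {gE} vE' : v = (s \o g) (j, l) by rewrite /= -gE permKV.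
    rewrite -[RHS]mulr1; congr (_ * _); have [_ y1] := y_fpm (w_good s w0).
    rewrite -(y1 j); apply: eq_bigl => I; congr (_ && _).
    by rewrite vE' mem_blocks.
  rewrite big_pred0 ?mulr0// => I; apply/negP => /andP[_ /imsetP[p pI vp]].
  by case/negP: vN; rewrite vp permK imset_f// !inE.
have n0 : 0 < n%:R :> R by rewrite ltr0n.
have md0 : 0 < (m * d)%:R :> R by rewrite ltr0n.
have Cm : 0 < 'C(m, q)%:R :> R by rewrite ltr0n bin_gt0.
have Cn : 0 < 'C(n, k)%:R :> R.
  by rewrite ltr0n bin_gt0 -qd (leq_trans _ WV)// leq_mul2r qW orbT.
have e0 : 0 < 1 - eps by rewrite subr_gt0.
have f0 : 0 < n`!%:R :> R by rewrite ltr0n fact_gt0.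
set W0 := n%:R / _ * _ / _.
have W0gt : 0 < W0 by rewrite /W0 !(mulr_gt0, invr_gt0).
have W0E : W0 = 'C(m, q)%:R * n`!%:R / 'C(n, k)%:R * Wmax.
  have E (a b c e f : R) : 0 < c -> 0 < e -> 0 < f ->
      a * (b / c) / e = b * f / c * (a / (e * f)).
    by move=> c0 ? ?; field; rewrite !gt_eqF.
  exact: E.
have wW e : e \in edges G -> \sum_(p : {perm V} * {set W} |
    (p.2 \in edges (H p.1)) && (phi p.1 p.2 == e)) perm_weight p.1 <= W0.
  move=> eG; apply: (le_trans (ler_sum _ (fun p _ => perm_weight_le p.1))).
  rewrite sumr_const W0E -[leLHS]mulr_natl.
  rewrite ler_wpM2r//; first exact: le_trans (perm_weight_ge0 1%g) (perm_weight_le _).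
  rewrite ler_pdivlMr// -!natrM ler_nat -(card_placements (edges_card eG)).
  rewrite leq_mul2r; apply/orP; right; apply/subset_leq_card/subsetP => p.
  by rewrite unfold_in inE /= => /andP[]; rewrite mem_block_hypergraph => /andP[-> _ ->].
have fpm := mixture_fpm k_gt0 phi_edge perm_weight_ge0 w_fpm cover.
have ent := mixture_entropy k_gt0 phi_edge perm_weight_ge0 w_fpm cover W0gt wW.
apply: (@le_trans _ _ (entropy G (mixture H phi perm_weight y))%:E); last first.
  by apply: ereal_sup_ubound; exists (mixture H phi perm_weight y).
rewrite lee_fin; apply: le_trans ent; rewrite -/n lerD2r -total_perm_weight mulr_suml.
apply: ler_sum => s _; have [->|wn0] := eqVneq (perm_weight s) 0; first by rewrite !mul0r.
have w0 : 0 < perm_weight s by rewrite lt_neqAle eq_sym wn0 perm_weight_ge0.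
by rewrite ler_pM2l// y_entropy// w_good.
Qed.

End GoodPermutations.

(** * Comparison of the thresholds *)

Lemma expR_beats_power (R : realType) (kappa e : R) (d : nat) : 0 < kappa -> 0 < e ->
  exists N : nat, forall n : nat, (N <= n)%N ->
    n%:R ^+ d.+1 * expR (- kappa * n%:R) <= e.
Proof.
move=> k0 e0; pose K : R := (d.+2)`!%:R / kappa ^+ d.+2.
have f0 : 0 < (d.+2)`!%:R :> R by rewrite ltr0n fact_gt0.
have K0 : 0 < K by rewrite divr_gt0// exprn_gt0.
exists (Num.truncn (K / e)).+1 => n Nn.
have n0 : 0 < n%:R :> R by rewrite ltr0n; exact: leq_trans Nn.
have Kn : K / e <= n%:R.
  by apply: ltW; apply: lt_le_trans (truncnS_gt _) _; rewrite ler_nat.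
have kn0 : 0 < kappa * n%:R by rewrite mulr_gt0.
have le1 : (kappa * n%:R) ^+ d.+2 / (d.+2)`!%:R <= expR (kappa * n%:R).
  by apply: le_trans (expR_ge1Dxn d.+1 (ltW kn0)); rewrite lerDr.
rewrite mulNr expRN ler_pdivrMr ?expR_gt0//.
apply: le_trans (ler_wpM2l (ltW e0) le1).
rewrite exprMn [n%:R ^+ d.+2]exprSr.
rewrite (_ : e * _ = n%:R ^+ d.+1 * (e * n%:R / K)).
  by rewrite ler_pMr ?exprn_gt0// ler_pdivlMr// mul1r mulrC -ler_pdivrMr.
rewrite /K; move: (_ ^+ d.+1) (kappa ^+ d.+2) (exprn_gt0 d.+2 k0) (_`!%:R) f0.
move=> a b b0 c c0.
by field; rewrite !gt_eqF.
Qed.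

Lemma min_deg_le (k d : nat) (V : finType) (G : uhypergraph k V) (A : {set V}) :
  #|A| = d -> (min_deg G d <= deg G A)%N.
Proof. by move=> /eqP cA; rewrite /min_deg -minEnat -leEnat; exact: bigmin_le_cond. Qed.

Lemma min_deg_attained (k d : nat) (V : finType) (G : uhypergraph k V) :
  (d <= #|V|)%N -> exists2 A : {set V}, #|A| = d & min_deg G d = deg G A.
Proof.
move=> dV; have : (0 < #|[set A : {set V} | #|A| == d]|)%N.
  by rewrite card_draws bin_gt0.
move=> /card_gt0P[A0]; rewrite inE => cA0.
have le_edges (A : {set V}) : #|A| == d -> (deg G A <= #|edges G|)%O.
  by move=> _; apply/subset_leq_card/subsetP => e; rewrite inE => /andP[].
have [A cA] := eq_bigmin A0 (fun A : {set V} => #|A| == d) (deg G) cA0 le_edges.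
by rewrite minEnat => AE; exists A => //; exact/eqP.
Qed.

Lemma bin_le_exp n r : ('C(n, r) <= n ^ r)%N.
Proof.
elim: r => [|r IH]; first by rewrite bin0.
apply: (@leq_trans (r.+1 * 'C(n, r.+1))); first by rewrite leq_pmull.
by rewrite mul_bin_left expnS leq_mul// leq_subr.
Qed.

Lemma card_bigcup_le (I T : finType) (F : I -> {set T}) :
  (#|\bigcup_i F i| <= \sum_i #|F i|)%N.
Proof.
elim/big_rec2: _ => [|i a A _ le]; first by rewrite cards0.
by apply: leq_trans (leq_card_setU _ _).1 _; rewrite leq_add2l.
Qed.

Lemma bin_trinomial n k d : (d <= k)%N -> (k <= n)%N ->
  ('C(n, k) * 'C(k, d) = 'C(n, d) * 'C(n - d, k - d))%N.
Proof.
move=> dk kn; apply/eqP.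
rewrite -(eqn_pmul2r (fact_gt0 d)) -(eqn_pmul2r (fact_gt0 (k - d))).
rewrite -(eqn_pmul2r (fact_gt0 (n - k))); apply/eqP.
have E1 := bin_fact dk; have E2 := bin_fact kn; have E3 := bin_fact (leq_trans dk kn).
have E4 : ('C(n - d, k - d) * ((k - d)`! * (n - k)`!) = (n - d)`!)%N.
  have -> : (n - k = n - d - (k - d))%N by lia.
  exact/bin_fact/leq_sub2r.
transitivity n`!; [rewrite -E2 -E1|rewrite -E3 -E4]; ring.
Qed.

Lemma injection_blocks (V : finType) (m d : nat) : (m * d <= #|V|)%N ->
  exists g : 'I_m * 'I_d -> V, injective g.
Proof.
move=> mdV; have cP : #|{: 'I_m * 'I_d}| = (m * d)%N by rewrite card_prod !card_ord.
have leV : (#|{: 'I_m * 'I_d}| <= #|V|)%N by rewrite cP.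
exists (fun p => enum_val (widen_ord leV (enum_rank p))).
move=> p p' /enum_val_inj/(congr1 val)/= /val_inj; exact: enum_rank_inj.
Qed.

Lemma bernoulli4 (R : realType) (e eps : R) :
  0 <= e -> 4 * e <= eps -> 1 - eps <= (1 - e) ^+ 4.
Proof.
move=> e0 e4; apply: (@le_trans _ _ (1 - 4 * e)); first by lra.
rewrite -subr_ge0 (_ : _ - _ = e ^+ 2 * ((e - 2) ^+ 2 + 2)); last by ring.
by rewrite mulr_ge0 ?sqr_ge0// addr_ge0 ?sqr_ge0.
Qed.

(** Up to factors 1 - eps, the left side is the argument of the logarithm in the
definition of [approx_counting]; on the right, the first two factors are the mean
degree in the block hypergraph, and the divisor is the weight that an edge receives
in [entropy_good_perms]. *)
Lemma averaging_constant (R : realType) (d k q n m : nat) (delta : R) :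
  (q * d)%N = k -> (0 < q)%N -> (0 < d)%N -> (q <= m)%N -> (k <= n)%N ->
  k%:R / n%:R * ('C(n, d)%:R / 'C(k, d)%:R) * delta =
  delta / 'C(n - d, k - d)%:R * 'C(m - 1, q - 1)%:R /
    (n%:R / (m * d)%:R * ('C(m, q)%:R / 'C(n, k)%:R)).
Proof.
move=> qd q0 d0 qm kn.
have dk : (d <= k)%N by rewrite -qd leq_pmull.
have m0 : (0 < m)%N by exact: leq_trans qm.
have n0 : (0 < n)%N by apply: leq_trans kn; exact: leq_trans dk.
have nz (i : nat) : (0 < i)%N -> i%:R != 0 :> R by rewrite pnatr_eq0 -lt0n.
have C1 := nz _ (etrans (bin_gt0 k d) dk).
have C2 := nz _ (etrans (bin_gt0 n k) kn).
have C3 := nz _ (etrans (bin_gt0 m q) qm).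
have C4 := nz _ (etrans (bin_gt0 (n - d) (k - d)) (leq_sub2r d kn)).
have -> : 'C(n, d)%:R / 'C(k, d)%:R = 'C(n, k)%:R / 'C(n - d, k - d)%:R :> R.
  by apply/eqP; rewrite eqr_div// -!natrM bin_trinomial.
have -> : 'C(m - 1, q - 1)%:R = q%:R * 'C(m, q)%:R / m%:R :> R.
  apply/eqP; rewrite eq_sym -[eqbRHS]divr1 eqr_div ?oner_neq0 ?nz//; apply/eqP.
  rewrite mulr1 -!natrM; congr (_%:R); have := mul_bin_diag m (q - 1).
  by rewrite -subn1 (_ : (q - 1).+1 = q) ?[(_ * m)%N]mulnC// subn1 prednK.
rewrite natrM [k%:R](_ : _ = q%:R * d%:R); last by rewrite -qd natrM.
move: (nz _ q0) (nz _ d0) (nz _ m0) (nz _ n0).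
move: C2 C3 C4.
move: ('C(n, k)%:R : R) ('C(m, q)%:R : R) ('C(_, _)%:R : R) => a b c a0 b0 c0.
move: (q%:R : R) (d%:R : R) (m%:R : R) (n%:R : R) => q' d' m' n' q1 d1 m1 n1.
by field; rewrite d1 m1 n1 a0 b0 c0.
Qed.

Lemma block_count (d q n1 n : nat) : (0 < d)%N -> (d * (n1 + q + 3) <= n)%N ->
  [/\ (n1 <= n %/ d)%N, (q <= n %/ d)%N, (0 < n %/ d)%N, (0 < n)%N &
      (n <= 3 * d * (n %/ d - 1))%N].
Proof.
move=> d0 dn; have m_ge : (n1 + q + 3 <= n %/ d)%N by rewrite leq_divRL// mulnC.
have lt_n := ltn_ceil n d0.
by split; nia.
Qed.

Section Lift.
Variables (R : realType) (d k q : nat).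
Hypotheses (qd : (q * d)%N = k) (q_gt1 : (1 < q)%N) (d_gt0 : (0 < d)%N).

(** The entropy of a hypergraph is a supremum: the second factor 1 - eps leaves room
for a fractional perfect matching that almost attains it. *)
Lemma entropy_dense_hypergraph (beta gamma eps : R) (n0 : nat) :
  0 < beta -> 0 < gamma -> 0 < eps -> eps < 1 ->
  (forall n : nat, (n0 <= n)%N ->
    forall (V : finType) (G : uhypergraph q V), #|V| = n ->
    (beta + gamma) * 'C(n - 1, q - 1)%:R <= (min_deg G 1)%:R ->
    ((n%:R / q%:R)%:E * lne ((1 - eps) * (q%:R / n%:R) * ('C(n, 1)%:R / 'C(q, 1)%:R)
            * (min_deg G 1)%:R)%:E <= hypergraph_entropy R G)%E) ->
  forall (W : finType) (H : uhypergraph q W) (theta : R),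
    (n0 <= #|W|)%N -> (0 < #|W|)%N -> 0 < theta ->
    (beta + gamma) * 'C(#|W| - 1, q - 1)%:R <= theta ->
    (forall i, theta <= (deg H [set i])%:R) ->
  exists2 y, fractional_perfect_matching H y &
    #|W|%:R / q%:R * ln ((1 - eps) ^+ 2 * theta) <= entropy H y.
Proof.
move=> b0 g0 e0 e1 ac W H theta n0W W0 t0 bt deg_ge.
have md : theta <= (min_deg H 1)%:R.
  by have [A /eqP/cards1P[i ->] ->] := min_deg_attained H W0.
have := ac _ n0W W H erefl (le_trans bt md).
have q0 : 0 < q%:R :> R by rewrite ltr0n (ltnW q_gt1).
have m0 : 0 < #|W|%:R :> R by rewrite ltr0n.
have em : 0 < 1 - eps by rewrite subr_gt0.
rewrite !bin1 (_ : _ * _ * _ * _ = (1 - eps) * (min_deg H 1)%:R); last first.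
  by field; rewrite !gt_eqF.
have md0 : 0 < (min_deg H 1)%:R :> R := lt_le_trans t0 md.
rewrite lne_EFin ?mulr_gt0// -EFinM => le1.
have lt1 : #|W|%:R / q%:R * ln ((1 - eps) ^+ 2 * theta) <
    #|W|%:R / q%:R * ln ((1 - eps) * (min_deg H 1)%:R).
  rewrite ltr_pM2l ?divr_gt0// ltr_ln ?posrE ?mulr_gt0 ?exprn_gt0//.
  rewrite expr2 -mulrA ltr_pM2l//; apply: lt_le_trans md.
  by rewrite gtr_pMl//; lra.
rewrite -lte_fin in lt1; have /ereal_sup_gt[_ [y yH <-]] := lt_le_trans lt1 le1.
by rewrite lte_fin => /ltW yB; exists y.
Qed.

(** The losses are four factors 1 - e: one from the hypothesis on beta, one from the
supremum in the entropy, one from the deviation eta of the degrees, and one from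
the proportion of bad permutations. *)
Lemma approx_counting_lift (beta : R) : 0 < beta ->
  approx_counting 1 q beta -> approx_counting d k beta.
Proof.
move=> b0 ac gamma eps g0 e0.
pose e := Num.min (eps / 4) (Num.min (gamma / 2) 2^-1).
have [e_gt0 e_eps e_gamma e_half] : [/\ 0 < e, 4 * e <= eps, e <= gamma / 2 & e <= 2^-1].
  have le1 : e <= eps / 4 by rewrite /e ge_min lexx.
  split; last by rewrite /e !ge_min lexx !orbT.
  - by rewrite /e !lt_min; apply/and3P; split; lra.
  - by lra.
  - by rewrite /e !ge_min lexx !orbT.
have e_lt1 : e < 1 by lra.
have g2 : 0 < gamma / 2 by lra.
have [n1 ac1] := ac (gamma / 2) e g2 e_gt0.
(* eta must be at most e * rho, at most gamma / 2, and not depend on n. *)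
pose rho0 := Num.min 1 (beta + gamma).
have rho0_gt0 : 0 < rho0 by rewrite lt_min; lra.
have rho0_le1 : rho0 <= 1 by rewrite ge_min lexx.
have rho0_le : rho0 <= beta + gamma by rewrite ge_min lexx orbT.
pose eta := e * rho0.
have eta_gt0 : 0 < eta by rewrite mulr_gt0.
have eta_e : eta <= e by rewrite ler_piMr// ltW.
have k_gt0 : (0 < k)%N by rewrite -qd muln_gt0 (ltnW q_gt1).
pose kappa : R := eta ^+ 2 / (288 * k%:R ^+ 2).
have kappa_gt0 : 0 < kappa.
  by rewrite divr_gt0 ?exprn_gt0 ?mulr_gt0 ?exprn_gt0 ?ltr0n.
have [n2 small] := expR_beats_power d kappa_gt0 e_gt0.
exists (maxn n2 (d * (n1 + q + 3)))%N => n; rewrite geq_max => /andP[n2n dn] V G cV degG.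
pose m := (n %/ d)%N.
have [n1m qm0 m_gt0 n_gt0 n3dm] := block_count d_gt0 dn.
rewrite -/m in n1m qm0 m_gt0 n3dm.
have nE := divn_eq n d; rewrite -/m in nE.
have rd : (n %% d < d)%N by rewrite ltn_mod.
have mdn : (m * d <= n)%N by rewrite nE leq_addr.
have nmd : (n - m * d < d)%N by rewrite {1}nE addKn.
have kn : (k <= n)%N by apply: leq_trans mdn; rewrite -qd leq_mul2r qm0 orbT.
have dk : (d <= k)%N by rewrite -qd leq_pmull// ltnW.
have [g g_inj] : exists g : 'I_m * 'I_d -> V, injective g.
  by apply: injection_blocks; rewrite cV.
have C0 : 0 < 'C(n - d, k - d)%:R :> R by rewrite ltr0n bin_gt0 leq_sub2r.
pose delta := (min_deg G d)%:R : R.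
pose rho := delta / 'C(n - d, k - d)%:R.
have rho_ge : beta + gamma <= rho by rewrite ler_pdivlMr.
have deg_ge (A : {set V}) : #|A| = d -> rho * 'C(#|V| - d, k - d)%:R <= (deg G A)%:R.
  by move=> cA; rewrite cV divfK ?gt_eqF// ler_nat min_deg_le.
have qm : (q <= #|'I_m|)%N by rewrite card_ord.
have VW : (#|V| <= 3 * d * (#|'I_m| - 1))%N by rewrite card_ord cV.
have kV : (k <= #|V|)%N by rewrite cV.
have eta1 : eta <= 1.
  by apply: (le_trans eta_e); apply: (le_trans e_half); rewrite invf_le1 ?ler1n.
pose bad := bad_perms q G g rho eta.
have card_bad := card_bad_perms qd q_gt1 d_gt0 qm VW kV g_inj deg_ge eta_gt0 eta1.
pose good := ~: \bigcup_i bad i.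
(* The n^(d+1) in [expR_beats_power] pays for the sum over the at most n blocks and
   for the at most n^d leftover sets. *)
have few_bad : #|~: good|%:R * 'C(#|V|, #|V| - #|'I_m| * d)%:R <= e * #|V| `!%:R.
  rewrite setCK cV card_ord.
  have mn : (m <= n)%N by rewrite leq_div.
  have le1 : #|\bigcup_i bad i|%:R <= n%:R * (n`!%:R * expR (- kappa * n%:R)).
    apply: (@le_trans _ _ (\sum_(i < m) #|bad i|%:R)).
      by rewrite -natr_sum ler_nat card_bigcup_le.
    apply: (le_trans (ler_sum _ (fun i _ => card_bad i))).
    rewrite cV -/kappa sumr_const card_ord -[leLHS]mulr_natl ler_wpM2r ?ler_nat//.
  have le2 : 'C(n, n - m * d)%:R <= n%:R ^+ d :> R.
    rewrite -natrX ler_nat; apply: leq_trans (bin_le_exp _ _) _.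
    by rewrite leq_pexp2l// ltnW.
  apply: (le_trans (ler_pM _ _ le1 le2)); rewrite ?ler0n//.
  rewrite [n`!%:R * _]mulrC mulrA mulrAC [_ * n%:R ^+ d]mulrAC -exprS.
  by rewrite ler_wpM2r// small.
pose D : R := 'C(m - 1, q - 1)%:R.
have D0 : 0 < D by rewrite ltr0n bin_gt0 leq_sub2r.
have good_deg s i : s \in good ->
    (rho - eta) * D <= (deg (block_hypergraph q G (s \o g)) [set i])%:R.
  rewrite inE => sg; rewrite leNgt; apply: contra sg => lt1.
  by apply/bigcupP; exists i => //; rewrite inE card_ord.
have rho_eta : beta + gamma / 2 <= rho - eta.
  by clear -rho_ge eta_e e_gamma; lra.
have bg2 : 0 < beta + gamma / 2 by rewrite addr_gt0 ?divr_gt0.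
have theta0 : 0 < (rho - eta) * D by rewrite mulr_gt0//; exact: lt_le_trans rho_eta.
have bt : (beta + gamma / 2) * 'C(#|'I_m| - 1, q - 1)%:R <= (rho - eta) * D.
  by rewrite card_ord -/D; apply: ler_wpM2r => //; exact: ltW.
have exy (s : {perm V}) : exists y, s \in good ->
    fractional_perfect_matching (block_hypergraph q G (s \o g)) y /\
    m%:R / q%:R * ln ((1 - e) ^+ 2 * ((rho - eta) * D)) <=
      entropy (block_hypergraph q G (s \o g)) y.
  have [sg|_] := boolP (s \in good); last by exists (fun=> 0).
  have [| |y y1 y2] := entropy_dense_hypergraph b0 g2 e_gt0 e_lt1 ac1 _ _ theta0 bt
    (fun i => good_deg s i sg); rewrite ?card_ord//.
  by exists y => _; rewrite card_ord in y2.
have [y yP] := choice exy.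
have y1 s (sg : s \in good) := (yP s sg).1.
have y2 s (sg : s \in good) := (yP s sg).2.
have WV : (#|'I_m| * d <= #|V|)%N by rewrite card_ord cV.
have := entropy_good_perms qd (ltnW q_gt1) d_gt0 qm WV g_inj e_lt1 few_bad y1 y2.
apply: le_trans; rewrite cV card_ord -/delta.
have n0 : 0 < n%:R :> R by rewrite ltr0n.
have k0 : 0 < k%:R :> R by rewrite ltr0n.
have [arg_le0|arg_gt0] := leP ((1 - eps) * (k%:R / n%:R) *
  ('C(n, d)%:R / 'C(k, d)%:R) * delta) 0.
  by rewrite le0_lneNy ?lee_fin// gt0_muleNy ?leNye// lte_fin divr_gt0.
rewrite lne_EFin// -EFinM lee_fin.
have mR0 : 0 < m%:R :> R by rewrite ltr0n.
have dR0 : 0 < d%:R :> R by rewrite ltr0n.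
have qR0 : 0 < q%:R :> R by rewrite ltr0n ltnW.
have kE : k%:R = q%:R * d%:R :> R by rewrite -qd natrM.
have Cm : 0 < 'C(m, q)%:R :> R by rewrite ltr0n bin_gt0.
have Cn : 0 < 'C(n, k)%:R :> R by rewrite ltr0n bin_gt0.
have Ckd : 0 < 'C(k, d)%:R :> R by rewrite ltr0n bin_gt0.
have e1 : 0 < 1 - e by rewrite subr_gt0.
set Q := (1 - e) ^+ 2 * _; set W0 := n%:R / _ * _ / _.
have Q0 : 0 < Q by rewrite mulr_gt0// exprn_gt0.
have W00 : 0 < W0 by rewrite /W0 natrM !(mulr_gt0, invr_gt0).
rewrite (_ : n%:R / (m * d)%:R * _ = n%:R / k%:R * ln Q); last first.
  by rewrite kE natrM mulrA; congr (_ * _); field; rewrite !gt_eqF.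
rewrite -mulrBr ler_pM2l ?divr_gt0// -ln_div ?posrE//.
have QW0 : 0 < Q / W0 := divr_gt0 Q0 W00.
rewrite ler_ln ?posrE//.
apply: (@le_trans _ _ ((1 - e) ^+ 4 *
  (k%:R / n%:R * ('C(n, d)%:R / 'C(k, d)%:R) * delta))).
  rewrite -2![(1 - eps) * _ * _]mulrA.
  apply: ler_wpM2r; first by rewrite !mulr_ge0 ?invr_ge0 ?ler0n.
  exact: bernoulli4 (ltW e_gt0) e_eps.
rewrite (averaging_constant delta qd (ltnW q_gt1) d_gt0 qm0 kn).
rewrite -/rho -/D /W0 /Q; set w := n%:R / _ * _.
have w0 : 0 < w by rewrite /w natrM !(mulr_gt0, invr_gt0).
have eta_rho : eta <= e * rho by rewrite /eta ler_pM2l// (le_trans rho0_le).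
have regroup (a b c : R) : 0 < a -> 0 < c ->
    a ^+ 4 * (b / c) = a ^+ 2 * (a * b) / (c / a).
  by move=> a0 c0; field; rewrite !gt_eqF.
rewrite (regroup _ _ _ e1 w0).
have we0 : 0 < (w / (1 - e))^-1 by rewrite invr_gt0; exact: divr_gt0.
rewrite (ler_pM2r we0) ler_pM2l ?exprn_gt0//.
by rewrite mulrA ler_pM2r// mulrBl mul1r lerD2l lerN2.
Qed.

End Lift.

Theorem theorem4p1 (R : realType) (d k : nat)
    (hd : (1 <= d)%N) (hdk : (d <= k - 1)%N) (hdvd : (d %| k)%N) :
  counting_threshold R d k <= counting_threshold R 1 (k %/ d)%N.
Proof.
have qd := divnK hdvd.
have q_gt1 : (1 < k %/ d)%N by move: qd hdk; case: (k %/ d)%N => [|[|//]] <-; lia.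
have [[b0 acb] _] := @counting_threshold_min R 1 (k %/ d) isT ltac:(lia).
have [_ min_dk] := @counting_threshold_min R d k hd hdk.
exact: min_dk b0 (approx_counting_lift qd q_gt1 hd b0 acb).
Qed.
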